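(* There exists an absolute constant $c_3>0$ such that for every irreducible (not necessarily reversible, discrete-time) Markov chain on a finite state space $V$ with transition matrix $P$ and stationary distribution $\pi$, $$c_3\, t_{\mathrm{rel}}^{\mathrm{Geom}}(1/e)\;\le\; t_{\mathrm{H}}^\pi\;\le\;\frac{1}{1-\sqrt b}\; t_{\mathrm{rel}}^{\mathrm{Geom}}(1/e),\qquad\text{where } b:=\frac{1+e^{-2}}{2}.$$
   Context: State spaces are assumed to have at least two elements. $(X_m)_{m\ge0}$ is the discrete-time chain with transition matrix $P$. For $A\subseteq V$, $T_A:=\inf\{m\ge0:X_m\in A\}$, $A^c:=V\setminus A$, and for nonempty $D$, $\pi_D(x):=\frac{\pi(x)}{\pi(D)}\mathbf 1\{x\in D\}$; $\mathbb{E}_\mu$ is expectation with initial distribution $\mu$. Define $$t_{\mathrm{H}}^\pi:=\max_{A\subsetneq V:\ \pi(A)\ge1/2}\mathbb{E}_{\pi_{A^c}}[T_A].$$ For real $t\ge1$ let $\eta_t$ be a random variable, independent of the chain, with $\mathbb{P}(\eta_t=i)=t^{-1}(1-1/t)^i$ for all integers $i\ge0$ (with $0^0=1$), and define the stochastic matrix $$P^{\mathrm{G}(t)}(x,y):=\mathbb{P}_x[X_{\eta_t}=y]=\sum_{m\ge0}P^m(x,y)\,\mathbb{P}[\eta_t=m].$$ Let $\Pi$ be the matrix all of whose rows equal $\pi$. For $f\in\mathbb{R}^V$ let $\|f\|_2:=(\sum_x\pi(x)f(x)^2)^{1/2}$, and for a $V\times V$ matrix $M$ let $\|M\|:=\max\{\|Mf\|_2:f\in\mathbb{R}^V,\|f\|_2=1\}$.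 For $\delta\in(0,1)$ define $$t_{\mathrm{rel}}^{\mathrm{Geom}}(\delta):=\inf\{t\ge1:\ \|P^{\mathrm{G}(t)}-\Pi\|\le\delta\}.$$ Equivalently, $t_{\mathrm{rel}}^{\mathrm{Geom}}(\delta)=\inf\{t\ge1:\beta_2((P^{\mathrm{G}(t)})^*P^{\mathrm{G}(t)})\le\delta^2\}$, where $\beta_2$ denotes the second largest eigenvalue and $Q^*(x,y):=\frac{\pi(y)}{\pi(x)}Q(y,x)$. *)

(* Defs.v *)
From HB Require Import structures.
From mathcomp Require Import all_boot all_order all_algebra.
From mathcomp Require Import all_classical all_reals all_analysis.
Set Implicit Arguments.
Unset Strict Implicit.
Unset Printing Implicit Defensive.
Import Order.TTheory GRing.Theory Num.Theory.
Import numFieldNormedType.Exports.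
Local Open Scope classical_set_scope.
Local Open Scope ring_scope.

(* Matrices indexed by the state space V are functions V -> V -> R. *)

Section transition_matrices.
Context {R : realType} {V : finType}.
Implicit Types (M P : V -> V -> R) (mu pi f : V -> R).

Definition distribution_on mu : Prop :=
  (forall x, 0 <= mu x) /\ \sum_x mu x = 1.

Definition stochastic P : Prop := forall x, distribution_on (P x).

Fixpoint mpow P (m : nat) : V -> V -> R :=
  if m is k.+1 then fun x y => \sum_z P x z * mpow P k z y
  else fun x y => (x == y)%:R.

Definition irreducible P : Prop := forall x y, exists m, 0 < mpow P m x y.

Definition stationary P pi : Prop :=
  distribution_on pi /\ forall y, \sum_x pi x * P x y = pi y.

Definition restrict_dist pi (D : {set V}) : V -> R :=
  fun x => if x \in D then pi x / \sum_(y in D) pi y else 0.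

(* [eta_t] is geometric on {0, 1, ...}: P(eta_t = m) = t^-1 (1 - 1/t)^m. *)
Definition geom_kernel P (t : R) : V -> V -> R :=
  fun x y => limn (series (fun m => mpow P m x y * (t^-1 * (1 - t^-1) ^+ m))).

Definition mapply M f : V -> R := fun x => \sum_y M x y * f y.

Definition l2norm pi f : R := Num.sqrt (\sum_x pi x * f x ^+ 2).

(* When pi is positive everywhere the unit sphere is compact, and this
   supremum is a maximum. *)
Definition opnorm pi M : R :=
  sup [set l2norm pi (mapply M f) | f in [set f | l2norm pi f = 1]].

(* Valued in \bar R, so that the infimum of an empty set would be +oo. *)
Definition trel_geom P pi (delta : R) : \bar R :=
  ereal_inf [set t%:E | t in [set t : R | 1 <= t /\
    opnorm pi (fun x y => geom_kernel P t x y - pi y) <= delta]].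

End transition_matrices.

Section chains.
Context {R : realType} {V : finType} {d : measure_display}
  {Omega : measurableType d}.
Implicit Types (P : V -> V -> R) (mu pi : V -> R) (X : nat -> Omega -> V)
  (Pr : probability Omega R) (A : {set V}).

(* The Markov property is written multiplicatively, so as to avoid
   conditioning on null events. *)
Definition markov_chain P mu Pr X : Prop :=
  [/\ forall m x, measurable [set w | X m w = x],
      forall x, Pr [set w | X 0%N w = x] = (mu x)%:E
    & forall (m : nat) (s : nat -> V),
        Pr [set w | forall i, (i <= m.+1)%N -> X i w = s i] =
        (Pr [set w | forall i, (i <= m)%N -> X i w = s i] *
         (P (s m) (s m.+1))%:E)%E].

(* A single process X with one law for each initial distribution, as on the
   canonical path space; the value of [Prob] elsewhere is irrelevant. *)
Definition markov_family P (Prob : (V -> R) -> probability Omega R) X : Prop :=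
  forall mu, distribution_on mu -> markov_chain P mu (Prob mu) X.

Definition hitting_time X A (w : Omega) : \bar R :=
  ereal_inf [set (m%:R)%:E | m in [set m : nat | X m w \in A]].

Definition tH (Prob : (V -> R) -> probability Omega R) X pi : \bar R :=
  \big[maxe/-oo%E]_(A : {set V} |
      (A \proper [set: V]%SET) && (2^-1 <= \sum_(x in A) pi x))
    (\int[Prob (restrict_dist pi (~: A))]_w hitting_time X A w)%E.

End chains.

(* Main.v *)
Require Import Defs.
From HB Require Import structures.
From mathcomp Require Import all_boot all_order all_algebra.
From mathcomp Require Import all_classical all_reals all_analysis.
From mathcomp Require Import measurable_realfun ring lra.
Set Implicit Arguments.
Unset Strict Implicit.
Unset Printing Implicit Defensive.
Import Order.TTheory GRing.Theory Num.Theory.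
Import numFieldNormedType.Exports.
Local Open Scope classical_set_scope.
Local Open Scope ring_scope.

(* Write L = I - P, q = 1 - 1/t and K = P^{G(t)}, so that K = I/t + q P K = I/t + q K P.

   Upper bound on t_H. For D of mass at most 1/2, the truncated expected exit
   time h from D satisfies P h >= h - 1, whence h <= K h + (t - 1). On functions
   supported in D the norm of K is at most sqrt b, because the mean of such a
   function carries at most half of its energy. So the L^2 norm of h is at most
   (t - 1) pi(D)^{1/2} / (1 - sqrt b), and Cauchy-Schwarz bounds its mean.

   Lower bound on t_H. Set T = t_H. It suffices that ||g|| <= C T ||L g|| for g of
   mean zero, since g = K f gives (t - 1) L g = f - g. Let u be the part of g above
   its median and f = (L g)_+. For a level s, let D_s = {u > s} and let h_s be the
   expected exit time from D_s for the time-reversed chain; by duality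
   E (u - s)_+ <= <h_s, f>. Applying the definition of T to the superlevel sets
   of h_s shows that h_s / T has exponential tails relative to pi(D_s), and a
   layer-by-layer interpolation of Marcinkiewicz type, summed over s, yields the
   L^2 bound. *)

(** * Functions on the state space *)

Section inner_product.
Context {R : realType} {V : finType}.
Implicit Types (K P : V -> V -> R) (pi f g h u v : V -> R) (D : {set V}).

Definition inner pi f g : R := \sum_x pi x * (f x * g x).

Lemma innerC pi f g : inner pi f g = inner pi g f.
Proof. by apply: eq_bigr => x _; rewrite (mulrC (f x)). Qed.

Lemma innerDr pi f g h :
  inner pi f (fun x => g x + h x) = inner pi f g + inner pi f h.
Proof. by rewrite -big_split; apply: eq_bigr => x _ /=; ring. Qed.

Lemma innerZr pi f g (a : R) : inner pi f (fun x => a * g x) = a * inner pi f g.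
Proof. by rewrite mulr_sumr; apply: eq_bigr => x _ /=; ring. Qed.

Lemma eq_inner pi f f' g g' : f =1 f' -> g =1 g' -> inner pi f g = inner pi f' g'.
Proof. by move=> ef eg; apply: eq_bigr => x _; rewrite ef eg. Qed.

Lemma inner_ge0 pi f : (forall x, 0 <= pi x) -> 0 <= inner pi f f.
Proof.
by move=> pi0; apply: sumr_ge0 => x _; rewrite mulr_ge0// -expr2 sqr_ge0.
Qed.

Lemma ler_inner pi f g h : (forall x, 0 <= pi x) -> (forall x, 0 <= f x) ->
  (forall x, 0 < f x -> g x <= h x) -> inner pi f g <= inner pi f h.
Proof.
move=> pi0 f0 gh; apply: ler_sum => x _; apply: ler_wpM2l => //.
have [f_gt0|f_le0] := ltP 0 (f x); first by rewrite ler_pM2l ?gh.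
by rewrite (@le_anti _ _ (f x) 0) ?f0 ?f_le0 // !mul0r.
Qed.

(** The squared norm of s f + t g is a nonnegative quadratic form in (s, t). When c > 0, take s = c
    and t = - b. When c = 0, the choice below makes the form equal to - b^2, forcing b = 0. *)
Lemma inner_CauchySchwarz pi f g : (forall x, 0 <= pi x) ->
  inner pi f g ^+ 2 <= inner pi f f * inner pi g g.
Proof.
move=> pi0; set a := inner pi f f; set b := inner pi f g; set c := inner pi g g.
have quad (s t : R) : 0 <= s ^+ 2 * a + 2 * s * t * b + t ^+ 2 * c.
  rewrite (_ : _ + _ = inner pi (fun x => s * f x + t * g x)
                                (fun x => s * f x + t * g x)) ?inner_ge0 //.
  rewrite /a /b /c /inner !mulr_sumr -!big_split /=.
  by apply: eq_bigr => x _; ring.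
have a0 : 0 <= a by exact: inner_ge0.
have c0 : 0 <= c by exact: inner_ge0.
have [c_gt0|] := ltP 0 c.
  by have := quad c (- b); nra.
move=> c_le0; have {c_le0}c_eq0 : c = 0 by apply: le_anti; rewrite c_le0 c0.
have := quad b (- (a + 1) / 2); rewrite c_eq0 !mulr0 addr0.
by nra.
Qed.

(** The adjoint of [P] in L^2(pi), that is, the transition matrix of the time-reversed chain. *)
Definition reversal P pi : V -> V -> R := fun x y => pi y * P y x / pi x.

Lemma inner_mapply_reversal P pi f g : (forall x, 0 < pi x) ->
  inner pi f (mapply P g) = inner pi (mapply (reversal P pi) f) g.
Proof.
move=> pi_gt0; rewrite /inner /mapply.
under eq_bigr do rewrite mulrA mulr_sumr.
rewrite exchange_big; apply: eq_bigr => y _ /=.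
rewrite mulrA [in RHS]mulrC [pi y * _]mulrC mulrA mulr_sumr mulr_suml.
apply: eq_bigr => x _; rewrite /reversal.
by field; rewrite gt_eqF.
Qed.

Lemma reversal_stochastic P pi : (forall x, 0 < pi x) -> stochastic P ->
  stationary P pi -> stochastic (reversal P pi).
Proof.
move=> pi_gt0 sP [_ statP] x; split=> [y|].
  by rewrite /reversal !mulr_ge0 ?(sP y).1 ?invr_ge0 ?(ltW (pi_gt0 _)).
by rewrite /reversal -mulr_suml statP divff ?gt_eqF.
Qed.

Lemma mapplyD K f g x : mapply K (fun x => f x + g x) x = mapply K f x + mapply K g x.
Proof. by rewrite -big_split; apply: eq_bigr => y _ /=; ring. Qed.

Lemma mapplyZ K (a : R) f x : mapply K (fun x => a * f x) x = a * mapply K f x.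
Proof. by rewrite mulr_sumr; apply: eq_bigr => y _ /=; ring. Qed.

Lemma mapply_cst K (a : R) x : stochastic K -> mapply K (fun=> a) x = a.
Proof. by move=> sK; rewrite /mapply -mulr_suml (sK x).2 mul1r. Qed.

Lemma ler_mapply K f g x : stochastic K -> (forall x, f x <= g x) ->
  mapply K f x <= mapply K g x.
Proof. by move=> sK fg; apply: ler_sum => y _; rewrite ler_wpM2l ?(sK x).1. Qed.

Lemma mapply_ge0 K f x : stochastic K -> (forall x, 0 <= f x) -> 0 <= mapply K f x.
Proof. by move=> sK f0; apply: sumr_ge0 => y _; rewrite mulr_ge0 ?(sK x).1. Qed.

Definition setind D : V -> R := fun x => (x \in D)%:R.

Lemma setind_in D x : x \in D -> setind D x = 1.
Proof. by rewrite /setind => ->. Qed.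

Lemma setind_out D x : x \notin D -> setind D x = 0.
Proof. by rewrite /setind => /negbTE->. Qed.

Definition pos_part_above f (s : R) : V -> R := fun x => Num.max (f x - s) 0.

Definition superlevel f (s : R) : {set V} := [set x | s < f x]%SET.

Lemma pos_part_above_ge0 f s x : 0 <= pos_part_above f s x.
Proof. by rewrite /pos_part_above le_max lexx orbT. Qed.

Lemma pos_part_above_setind f s x :
  pos_part_above f s x = setind (superlevel f s) x * (f x - s).
Proof.
rewrite /pos_part_above /setind inE; case: ltP => fs.
  by rewrite mul1r max_l// subr_ge0 ltW.
by rewrite mul0r max_r// subr_le0.
Qed.

(** The truncation (f - s)_+ dominates f - s everywhere and equals it on {f > s}. Averaging by [K]
    can thus only increase it, so I - K can only decrease at points of the superlevel set. *)
Lemma pos_part_above_superharmonic K f s x : stochastic K -> x \in superlevel f s ->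
  pos_part_above f s x - mapply K (pos_part_above f s) x <= f x - mapply K f x.
Proof.
move=> sK xs; rewrite pos_part_above_setind /setind xs mul1r.
have : mapply K f x - s <= mapply K (pos_part_above f s) x.
  have -> : mapply K f x - s = mapply K (fun y => f y + - s) x.
    by rewrite mapplyD (mapply_cst (- s) x sK).
  by apply: ler_mapply => // y; rewrite /pos_part_above le_max lexx.
by lra.
Qed.

End inner_product.

(** * Expected exit times *)

Lemma cvg_sum (R : realType) (I : finType) (u : nat -> I -> R) (l : I -> R) :
  (forall i, u n i @[n --> \oo] --> l i) ->
  \sum_i u n i @[n --> \oo] --> \sum_i l i.
Proof. by move=> ul; apply: cvg_big => //; exact: add_continuous. Qed.

Section hitting.
Context {R : realType} {V : finType}.
Implicit Types (K P : V -> V -> R) (pi f g h u v : V -> R) (D : {set V}).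

Definition mean pi h : R := \sum_x pi x * h x.

(** The Dirichlet problem (I - K) h = 1 on [D], h = 0 off [D], whose solution stands for the
    expected exit time from [D]. *)
Definition hits K D h : Prop :=
  [/\ forall x, 0 <= h x, forall x, x \notin D -> h x = 0
    & forall x, x \in D -> h x = 1 + mapply K h x].

(* [survival K D k x] is the probability, starting from [x], that the chain
   stays in [D] at the times 0, ..., k. *)
Fixpoint survival K D (k : nat) : V -> R :=
  if k is j.+1 then fun x => setind D x * mapply K (survival K D j) x
  else setind D.

(** By the tail-sum formula this is the expectation of the minimum of [N] and the exit time from
    [D]; truncation keeps it finite before any bound is known. *)
Definition trunc_hits K D (N : nat) : V -> R :=
  fun x => \sum_(k < N) survival K D k x.

Lemma survival_ge0 K D k x : stochastic K -> 0 <= survival K D k x.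
Proof.
move=> sK; elim: k x => [|k IH] x /=; first by rewrite /setind ler0n.
by rewrite mulr_ge0 ?ler0n ?mapply_ge0.
Qed.

Lemma trunc_hits_ge0 K D N x : stochastic K -> 0 <= trunc_hits K D N x.
Proof. by move=> sK; apply: sumr_ge0 => k _; exact: survival_ge0. Qed.

Lemma trunc_hits_le K D N x : stochastic K ->
  trunc_hits K D N x <= trunc_hits K D N.+1 x.
Proof.
by move=> sK; rewrite /trunc_hits big_ord_recr /= lerDl survival_ge0.
Qed.

Lemma trunc_hitsS K D N x : trunc_hits K D N.+1 x =
  setind D x * (1 + mapply K (trunc_hits K D N) x).
Proof.
rewrite /trunc_hits big_ord_recl /= mulrDr mulr1; congr (_ + _).
rewrite /mapply [X in _ * X](_ : _ =
    \sum_(k < N) \sum_y K x y * survival K D k y).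
  by rewrite mulr_sumr; apply: eq_bigr.
by rewrite exchange_big; apply: eq_bigr => y _; rewrite mulr_sumr.
Qed.

Lemma trunc_hits_out K D N x : x \notin D -> trunc_hits K D N x = 0.
Proof.
move=> xD; case: N => [|N]; first by rewrite /trunc_hits big_ord0.
by rewrite trunc_hitsS setind_out// mul0r.
Qed.

(** The truncated times increase with [N], and a bound on their means bounds each value because [pi]
    is positive. They converge, and the first-step recursion passes to the limit. *)
Lemma hits_of_bounded K pi D (B : R) : (forall x, 0 < pi x) -> stochastic K ->
  (forall N, mean pi (trunc_hits K D N) <= B) ->
  exists h, hits K D h /\ mean pi h <= B.
Proof.
move=> pi_gt0 sK bdd.
have incr x : nondecreasing_seq (fun N => trunc_hits K D N x).
  by apply/nondecreasing_seqP => N; exact: trunc_hits_le.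
have ubx x N : trunc_hits K D N x <= B / pi x.
  rewrite ler_pdivlMr// mulrC; apply: le_trans (bdd N).
  rewrite /mean (bigD1 x)//= lerDl sumr_ge0// => y _.
  by rewrite mulr_ge0 ?trunc_hits_ge0 ?ltW.
have cv x : cvgn (fun N => trunc_hits K D N x).
  apply: nondecreasing_is_cvgn; first exact: incr.
  by exists (B / pi x) => _ [N _ <-].
pose h x := limn (fun N => trunc_hits K D N x).
have cvh x : trunc_hits K D N x @[N --> \oo] --> h x by exact: cv.
have fixed x : h x = setind D x * (1 + mapply K h x).
  apply: (@cvg_unique _ (@Rhausdorff R) (trunc_hits K D N.+1 x @[N --> \oo])).
    have := cvh x; rewrite -(cvg_shiftS (fun N => trunc_hits K D N x)).
    by apply.
  rewrite /= (_ : (fun N => _) = (fun N =>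
    setind D x * (1 + mapply K (trunc_hits K D N) x))); last first.
    by apply/funext => N; rewrite trunc_hitsS.
  apply: cvgMl_tmp; apply: cvgD; first exact: cvg_cst.
  by apply: cvg_sum => y; exact: cvgMl_tmp.
exists h; split.
  split=> [x|x xD|x xD].
  - apply: (@limr_ge _ _ _ _ 0) => //; apply: nearW => N.
    exact: trunc_hits_ge0.
  - by rewrite fixed setind_out// mul0r.
  - by rewrite {1}fixed setind_in// mul1r.
have cvm : mean pi (trunc_hits K D N) @[N --> \oo] --> mean pi h.
  by apply: cvg_sum => x; exact: cvgMl_tmp.
rewrite -(cvg_lim (@Rhausdorff R) cvm).
by apply: limr_le; [apply/cvg_ex; eexists; exact: cvm|exact: nearW].
Qed.

Lemma inner_setind_mean pi D h : (forall x, x \notin D -> h x = 0) ->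
  inner pi (setind D) h = mean pi h.
Proof.
move=> h0; apply: eq_bigr => x _; have [xD|xD] := boolP (x \in D).
  by rewrite setind_in// mul1r.
by rewrite h0// mulr0.
Qed.

Lemma inner_laplacian_reversal P pi f g : (forall x, 0 < pi x) ->
  inner pi f (fun x => g x - mapply P g x) =
  inner pi g (fun x => f x - mapply (reversal P pi) f x).
Proof.
move=> pi_gt0.
have split_inner (a b c : V -> R) :
    inner pi a (fun x => b x - c x) = inner pi a b - inner pi a c.
  rewrite -[X in _ = _ + X]mulN1r -innerZr -innerDr.
  by apply: eq_inner => // x; rewrite mulN1r.
by rewrite !split_inner inner_mapply_reversal// innerC [inner pi (mapply _ _) _]innerC.
Qed.

(** The truncated exit time k of the reversed chain satisfies k - P' k <= 1 on [D], so mean k = <k,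
    (I - P) h> = <h, (I - P') k> <= mean h. This bound is uniform in the truncation. *)
Lemma hits_reversal P pi D h : (forall x, 0 < pi x) -> stochastic P ->
  stationary P pi -> hits P D h -> exists k, hits (reversal P pi) D k.
Proof.
move=> pi_gt0 sP statP [h0 hout hin].
have sP' := reversal_stochastic pi_gt0 sP statP; set P' := reversal P pi in sP' *.
have [|k [hk _]] := @hits_of_bounded P' pi D (mean pi h) pi_gt0 sP'; last by exists k.
move=> N; set k := trunc_hits P' D N.
have kout x : x \notin D -> k x = 0 by exact: trunc_hits_out.
rewrite -(inner_setind_mean pi kout) -(inner_setind_mean pi hout) innerC.
have pi_ge0 x : 0 <= pi x by exact: ltW.
apply: (@le_trans _ _ (inner pi k (fun x => h x - mapply P h x))).
  apply: ler_inner => // x; first exact: trunc_hits_ge0.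
  have [xD|/kout->] := boolP (x \in D); last by rewrite ltxx.
  by rewrite setind_in// hin// addrK.
rewrite inner_laplacian_reversal// -/P' [leRHS]innerC.
apply: ler_inner => // x.
have [xD _|/hout->] := boolP (x \in D); last by rewrite ltxx.
have := trunc_hits_le D N x sP'.
by rewrite trunc_hitsS setind_in// mul1r -/k; lra.
Qed.

End hitting.

(** * The Poincare inequality *)

Section level_sums.
Context {R : realType}.
Implicit Types (a b c u z : R).

(** Each level b i lying below [a] contributes a layer of height [b]. The induction bounds min(a, b
    M), so the upper bound on [a] enters only at the end. *)
Lemma layer_cake_le a b (M : nat) : 0 <= b -> a <= b * M%:R ->
  a <= \sum_(i < M) b * (b * i%:R < a)%R%:R.
Proof.
move=> b0; have minP : Num.min a (b * M%:R) <= \sum_(i < M) b * (b * i%:R < a)%R%:R.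
  elim: M => [|M IH]; first by rewrite mulr0 big_ord0 ge_min lexx orbT.
  rewrite big_ord_recr /=; move: IH; set S := \sum_(i < M) _.
  have [bMa|abM] := ltP (b * M%:R) a.
    move=> IH; rewrite ge_min; apply/orP; right.
    by rewrite mulr1 -natr1 mulrDr mulr1 lerD2r.
  by move=> IH; rewrite mulr0 addr0 ge_min IH.
by move=> abM; move: minP; rewrite min_l.
Qed.

Lemma count_multiples_lt c z (N : nat) : 0 < c -> 0 <= z ->
  \sum_(j < N) ((c * j.+1%:R < z)%R%:R : R) <= z / c.
Proof.
move=> c0 z0; rewrite ler_pdivlMr// mulrC mulr_sumr.
(* The extra bound c N closes the induction: if c (N + 1) < z, adding one more [c] still stays below
   z. *)
suff: \sum_(i < N) c * ((c * i.+1%:R < z)%R%:R : R) <= Num.min z (c * N%:R).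
  by rewrite le_min => /andP[].
elim: N => [|N]; first by rewrite big_ord0 mulr0 le_min z0 lexx.
rewrite big_ord_recr /=; set S := \sum_(i < N) _.
rewrite !le_min => /andP[Sz SN]; rewrite -natr1 mulrDr mulr1.
case: ltP => [cNz|zcN]; last by rewrite mulr0 addr0 Sz; apply/andP; split=> //; lra.
by rewrite mulr1; apply/andP; split; lra.
Qed.

(** Every integer counted is below [u], and there are at most [u] of them. *)
Lemma sum_below_le_sqr u (N : nat) : 0 <= u ->
  \sum_(j < N) j.+1%:R * ((j.+1%:R < u)%R%:R : R) <= u ^+ 2.
Proof.
move=> u0; rewrite expr2; apply: (@le_trans _ _
    (u * \sum_(j < N) ((1 * j.+1%:R < u)%R%:R : R))).
  rewrite mulr_sumr; apply: ler_sum => j _; rewrite mul1r.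
  by case: ltP => [/ltW|_]; rewrite ?mulr1 ?mulr0.
by apply: ler_wpM2l => //; rewrite -[leRHS]divr1; exact: count_multiples_lt.
Qed.

(** A right-endpoint Riemann sum for the integral of (u - s)_+ over s >= 0, which is u^2 / 2.
    Peeling off the first term replaces [u] by u - 1. *)
Lemma sum_excess_ge u (N : nat) : u <= N%:R ->
  u ^+ 2 / 2 - u <= \sum_(j < N) Num.max (u - j.+1%:R) 0 \/ u < 0.
Proof.
elim: N u => [|N IH] u uN.
  have [?|u0] := ltP u 0; first by right.
  by left; rewrite big_ord0 (_ : u = 0) ?expr0n/= ?mul0r ?subrr//; apply: le_anti; rewrite uN.
have [?|u0] := ltP u 0; [by right|left].
rewrite big_ord_recl /=.
have tail0 : 0 <= \sum_(i < N) Num.max (u - (bump 0 i).+1%:R) 0.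
  by apply: sumr_ge0 => i _; rewrite le_max lexx orbT.
have [u1|u1] := ltP u 1.
  have : 0 <= Num.max (u - 1) 0 by rewrite le_max lexx orbT.
  by move: tail0; nra.
have uN' : u - 1 <= N%:R by move: uN; rewrite -natr1; lra.
have [|] := IH _ uN'; last by lra.
rewrite (eq_bigr (fun i : 'I_N => Num.max (u - (bump 0 i).+1%:R) 0)); last first.
  by move=> i _; rewrite /bump /= add1n -[in RHS]natr1 opprD addrA addrAC.
have : u - 1 <= Num.max (u - 1) 0 by rewrite le_max lexx.
by set S := \sum_(i < N) _; set m := Num.max _ _; nra.
Qed.

Lemma geometric_sum_le (q : R) (M : nat) : 0 <= q -> q < 1 ->
  \sum_(i < M) q ^+ i <= (1 - q)^-1.
Proof.
move=> q0 q1; rewrite -[leRHS]mul1r ler_pdivlMr ?subr_gt0// mulrC.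
by rewrite -[1 - q]opprB mulNr -subrX1 opprB lerBlDr lerDl exprn_ge0.
Qed.

End level_sums.

(** * Exit times from superlevel sets *)

Section level_sets.
Context {R : realType} {V : finType}.
Variables (P : V -> V -> R) (pi : V -> R).
Implicit Types (f g h u v : V -> R) (D : {set V}).

Definition mass D : R := mean pi (setind D).

(* The analytic form of the bound [tH <= T]. *)
Definition quick_hits (T : R) : Prop := forall D, mass D <= 2^-1 ->
  exists h, hits P D h /\ mean pi h <= T * mass D.

Hypotheses (sP : stochastic P) (statP : stationary P pi).
Hypothesis pi_gt0 : forall x, 0 < pi x.

Local Notation Q := (reversal P pi).

Let pi_ge0 x : 0 <= pi x. Proof. exact: ltW. Qed.

Let sQ : stochastic Q. Proof. exact: reversal_stochastic. Qed.

Lemma ler_mean f g : (forall x, f x <= g x) -> mean pi f <= mean pi g.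
Proof. by move=> fg; apply: ler_sum => x _; rewrite ler_wpM2l. Qed.

Lemma meanZ (a : R) f : mean pi (fun x => a * f x) = a * mean pi f.
Proof. by rewrite mulr_sumr; apply: eq_bigr => x _; rewrite mulrCA. Qed.

Lemma mean_sum (I : finType) (F : I -> V -> R) :
  mean pi (fun x => \sum_i F i x) = \sum_i mean pi (F i).
Proof.
by rewrite exchange_big; apply: eq_bigr => x _ /=; rewrite mulr_sumr.
Qed.

Lemma mass_superlevel_le u (s t : R) : s <= t ->
  mass (superlevel u t) <= mass (superlevel u s).
Proof.
move=> st; apply: ler_mean => x; rewrite /setind !inE ler_nat.
by case: (ltP t (u x)) => // /(le_lt_trans st) ->.
Qed.

Lemma mass_le1 D : mass D <= 1.
Proof.
rewrite -(statP.1.2); apply: ler_sum => x _.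
by rewrite ler_piMr// /setind lern1 leq_b1.
Qed.

(* [A] and [B] are [P] and its time reversal, in either order. *)
Lemma mean_le_inner_hits A B D h v f :
  (forall f g, inner pi f (fun x => g x - mapply A g x) =
               inner pi g (fun x => f x - mapply B f x)) ->
  hits A D h -> (forall x, 0 <= v x) -> (forall x, x \notin D -> v x = 0) ->
  (forall x, x \in D -> v x - mapply B v x <= f x) ->
  mean pi v <= inner pi h f.
Proof.
move=> adjoint [h0 hout hin] v0 vout vf.
rewrite -(inner_setind_mean pi vout) innerC.
(* On [D], which carries [v], h - A h = 1. Adjointness then moves the Laplacian from h onto [v]. *)
apply: (@le_trans _ _ (inner pi v (fun x => h x - mapply A h x))).
  apply: ler_inner => // x; have [xD _|/vout->] := boolP (x \in D); last by rewrite ltxx.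
  by rewrite setind_in// hin// addrK.
rewrite adjoint; apply: ler_inner => // x.
by have [xD _|/hout->] := boolP (x \in D); [exact: vf|rewrite ltxx].
Qed.

Variable T : R.
Hypotheses (T_gt0 : 0 < T) (quickP : quick_hits T).

(** The excess (k - s)_+ has reversed Laplacian at most 1 on D' = {k > s}, a subset of [D] as s >=
    0. Duality compares its mean with the mean exit time of [P] from D', which [quickP] controls. *)
Lemma reverse_hits_excess D k (s : R) : mass D <= 2^-1 -> hits Q D k -> 0 <= s ->
  mean pi (pos_part_above k s) <= T * mass (superlevel k s).
Proof.
move=> D_half [k0 kout kin] s0; set D' := superlevel k s.
have D'D x : x \in D' -> x \in D.
  by rewrite inE => sk; apply: contraLR sk => /kout->; rewrite -leNgt.
have [|h [hitsh meanh]] := quickP (_ : mass D' <= 2^-1).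
  apply: le_trans D_half; apply: ler_mean => x; rewrite /setind ler_nat.
  by case: (boolP (x \in D')) => // /D'D ->.
apply: le_trans meanh; rewrite [leRHS](_ : _ = inner pi h (fun=> 1)); last first.
  by apply: eq_bigr => x _; rewrite mulr1.
have adjoint f g := inner_laplacian_reversal P f g pi_gt0.
apply: (mean_le_inner_hits adjoint hitsh) => [x|x xD'|x xD'].
- exact: pos_part_above_ge0.
- by rewrite pos_part_above_setind setind_out// mul0r.
- apply: le_trans (pos_part_above_superharmonic sQ xD') _.
  by rewrite kin ?D'D// addrK.
Qed.

(** The excess over s is at least 2 T where k > s + 2 T, while its mean is at most T times the mass
    of {k > s}. By Markov's inequality the mass halves with each further 2 T. *)
Lemma reverse_hits_tail D k (i : nat) : mass D <= 2^-1 -> hits Q D k ->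
  mass (superlevel k (2 * T * i%:R)) <= 2^-1 ^+ i * mass D.
Proof.
move=> D_half hitsk; have [k0 kout kin] := hitsk.
have T2_gt0 : 0 < 2 * T by rewrite mulr_gt0.
elim: i => [|i IH].
  rewrite mulr0 expr0 mul1r; apply: ler_mean => x; rewrite /setind inE ler_nat.
  by have [|/kout->] := boolP (x \in D); [rewrite leq_b1|rewrite ltxx].
set s := 2 * T * i%:R in IH *.
have s0 : 0 <= s by rewrite mulr_ge0// ltW.
have := reverse_hits_excess D_half hitsk s0.
suff: (2 * T) * mass (superlevel k (2 * T * i.+1%:R)) <= mean pi (pos_part_above k s).
  move=> H1 H2; have {H1 H2} := le_trans H1 H2.
  rewrite -mulrA mulrCA ler_pM2l// => H.
  apply: (@le_trans _ _ (2^-1 * mass (superlevel k s))); first by rewrite ler_pdivlMl.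
  by rewrite exprS -[leRHS]mulrA ler_pM2l.
rewrite -meanZ; apply: ler_mean => x.
rewrite /setind inE; case: ltP => [kx|_]; last by rewrite mulr0 pos_part_above_ge0.
rewrite mulr1 /pos_part_above le_max; apply/orP; left.
by move: kx; rewrite -[i.+1%:R]natr1 mulrDr mulr1 -/s; lra.
Qed.

(* [k] decays geometrically by [reverse_hits_tail]; cutting [f] at the growing
   heights [eps * (3/2)^i * s] makes both resulting sums over [i] converge. *)
Lemma level_bound u f (eps s : R) (M : nat) :
  (forall x, 0 <= u x) -> (forall x, 0 <= f x) -> mass (superlevel u 0) <= 2^-1 ->
  (forall x, x \in superlevel u 0 -> u x - mapply P u x <= f x) ->
  (forall x, 1 <= 2 * M%:R * pi x) -> 0 < eps -> 0 <= s ->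
  mean pi (pos_part_above u s) <= 2 * T * (4 * eps * (s * mass (superlevel u s)) +
    mean pi (fun x => f x * \sum_(i < M) (eps * (3 / 2) ^+ i * s < f x)%R%:R)).
Proof.
move=> u0 f0 D0_half uf HM eps0 s0; set D := superlevel u s.
have D_half : mass D <= 2^-1 by apply: le_trans D0_half; exact: mass_superlevel_le.
have DD0 x : x \in D -> x \in superlevel u 0 by rewrite !inE; exact: le_lt_trans.
have [h [hitsh _]] := quickP D_half.
have [k hitsk] := hits_reversal pi_gt0 sP statP hitsh.
have [k0 kout kin] := hitsk.
have T2_ge0 : 0 <= 2 * T by rewrite mulr_ge0// ltW.
(* The crude bound pi x * k x <= mean k <= T; together with the choice of [M] it shows that [M]
   layers of height 2 T cover [k]. *)
have k_le x : k x <= 2 * T * M%:R.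
  have H1 := reverse_hits_excess D_half hitsk (lexx 0).
  have H2 : pi x * k x <= T * 1.
    apply: le_trans (ler_wpM2l (ltW T_gt0) (mass_le1 _)).
    apply: le_trans H1; rewrite /mean (bigD1 x)//=.
    rewrite {1}/pos_part_above subr0 max_l// lerDl sumr_ge0// => y _.
    by rewrite mulr_ge0// pos_part_above_ge0.
  rewrite -(ler_pM2l (pi_gt0 x)); apply: le_trans H2 _.
  rewrite [leRHS](_ : _ = T * (2 * M%:R * pi x)); last by ring.
  by rewrite ler_pM2l.
have v_le : mean pi (pos_part_above u s) <= inner pi k f.
  (* Here the exit time belongs to the reversed chain and the Laplacian of [u] to [P], so the
     duality is used the other way round. *)
  have adjoint a b := esym (inner_laplacian_reversal P b a pi_gt0).
  apply: (mean_le_inner_hits adjoint hitsk) => [x|x xD|x xD].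
  - exact: pos_part_above_ge0.
  - by rewrite pos_part_above_setind setind_out// mul0r.
  - by apply: le_trans (pos_part_above_superharmonic sP xD) _; apply: uf; exact: DD0.
apply: le_trans v_le _.
pose lam (i : nat) := eps * (3 / 2) ^+ i * s.
have lam0 i : 0 <= lam i.
  by rewrite mulr_ge0// mulr_ge0 ?(ltW eps0)// exprn_ge0// divr_ge0.
(* Slice [k] into layers {k > 2 T i}; on layer i, [f] is at most [lam i] plus the part of [f] where
   it exceeds [lam i]. *)
apply: (@le_trans _ _ (mean pi (fun x => 2 * T * (
    \sum_(i < M) lam i * setind (superlevel k (2 * T * i%:R)) x +
    f x * \sum_(i < M) (lam i < f x)%R%:R)))).
  apply: ler_mean => x; rewrite mulr_sumr -big_split /=.
  apply: le_trans (ler_wpM2r (f0 x) (layer_cake_le T2_ge0 (k_le x))) _.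
  rewrite mulr_suml mulr_sumr; apply: ler_sum => i _.
  rewrite -[leLHS]mulrA ler_wpM2l// /setind inE.
  have := f0 x; have := lam0 i.
  by case: (ltP (lam i) (f x)); case: (_ < k x) => /=; lra.
rewrite meanZ ler_wpM2l//.
rewrite [leLHS](_ : _ =
   mean pi (fun x => \sum_(i < M) lam i * setind (superlevel k (2 * T * i%:R)) x) +
   mean pi (fun x => f x * \sum_(i < M) (lam i < f x)%R%:R)); last first.
  by rewrite -big_split; apply: eq_bigr => x _; rewrite mulrDr.
rewrite lerD2r mean_sum.
(* The heights grow by 3/2 while the tail masses halve, leaving the ratio 3/4, whose geometric
   series sums to 4. *)
apply: (@le_trans _ _ (\sum_(i < M) eps * (s * mass D) * (3 / 4) ^+ i)).
  apply: ler_sum => i _; rewrite meanZ.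
  apply: le_trans (ler_wpM2l (lam0 i) (reverse_hits_tail i D_half hitsk)) _.
  rewrite le_eqVlt; apply/orP; left; apply/eqP.
  rewrite (_ : 3 / 4 = (3 / 2) * 2^-1); last by field.
  by rewrite exprMn /lam; ring.
rewrite -mulr_sumr [leRHS](_ : _ = eps * (s * mass D) * 4); last by ring.
have mD0 : 0 <= mass D by apply: sumr_ge0 => x _; rewrite mulr_ge0.
apply: ler_wpM2l; first by rewrite !mulr_ge0// ltW.
apply: le_trans (geometric_sum_le M _ _) _; [lra|lra|].
by rewrite le_eqVlt; apply/orP; left; apply/eqP; field.
Qed.

End level_sets.

(** * From level sets to the L^2 inequality *)

Section poincare.
Context {R : realType} {V : finType}.
Variables (P : V -> V -> R) (pi : V -> R).
Implicit Types (f g u : V -> R).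

Hypotheses (sP : stochastic P) (statP : stationary P pi).
Hypothesis pi_gt0 : forall x, 0 < pi x.
Variable T : R.
Hypotheses (T_gt0 : 0 < T) (quickP : quick_hits P pi T).

Let pi_ge0 x : 0 <= pi x. Proof. exact: ltW. Qed.

Lemma finite_nat_bound (a : V -> R) : exists N : nat, forall x, a x <= N%:R.
Proof.
exists (\sum_x Num.bound `|a x|)%N => x.
apply: le_trans (ler_norm _) _; apply: le_trans (ltW (archi_boundP (normr_ge0 _))) _.
by rewrite ler_nat (bigD1 x)//= leq_addr.
Qed.

(* Summing [level_bound] over the integer levels; the gap hypothesis makes the
   error of this discretization of the integral of [s] negligible, and is
   harmless since both sides scale alike. *)
Lemma energy_bound_gap u f : (forall x, u x = 0 \/ 4 <= u x) ->
  (forall x, 0 <= f x) -> mass pi (superlevel u 0) <= 2^-1 ->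
  (forall x, x \in superlevel u 0 -> u x - mapply P u x <= f x) ->
  inner pi u u <= 3072 * T ^+ 2 * inner pi f f.
Proof.
move=> ugap f0 D0_half uf.
have u0 x : 0 <= u x by case: (ugap x) => [->//|]; exact: le_trans.
have [N uN] := finite_nat_bound u.
have [M piM] := finite_nat_bound (fun x => (2 * pi x)^-1).
have HM x : 1 <= 2 * M%:R * pi x.
  have := piM x; rewrite -[leLHS]mul1r ler_pdivrMr ?mulr_gt0//.
  by rewrite mulrA [M%:R * 2]mulrC.
(* With this value the energy of [u] on the right has coefficient 2 T * 4 eps = 1/8, half of the 1/4
   on the left; the other term is 6 T / eps = 384 T^2, and 8 * 384 = 3072. *)
pose eps := (64 * T)^-1; have eps0 : 0 < eps by rewrite invr_gt0 mulr_gt0.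
(* The gap enters here: u^2 / 2 - u >= u^2 / 4 as soon as u >= 4. *)
have lower : inner pi u u / 4 <= \sum_(j < N) mean pi (pos_part_above u j.+1%:R).
  rewrite -mean_sum mulrC /inner mulr_sumr; apply: ler_sum => x _.
  rewrite mulrCA; apply: ler_wpM2l => //.
  have [H|] := sum_excess_ge (uN x); last by have := u0 x; lra.
  by apply: le_trans H; case: (ugap x) => [->|ux]; nra.
have upper : \sum_(j < N) mean pi (pos_part_above u j.+1%:R) <=
    2 * T * (4 * eps * inner pi u u + 3 / eps * inner pi f f).
  have level (j : 'I_N) := level_bound sP statP pi_gt0 T_gt0 quickP
    u0 f0 D0_half uf HM eps0 (ler0n R j.+1).
  apply: le_trans (ler_sum _ (fun j _ => level j)) _.
  rewrite -mulr_sumr ler_wpM2l ?mulr_ge0 ?(ltW T_gt0)//.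
  rewrite big_split /=; apply: lerD.
    rewrite -mulr_sumr ler_wpM2l ?mulr_ge0 ?(ltW eps0)//.
    under eq_bigr do rewrite /mass -meanZ.
    rewrite -mean_sum; apply: ler_mean => // x.
    rewrite -expr2; apply: le_trans (sum_below_le_sqr N (u0 x)).
    by apply: ler_sum => j _; rewrite /setind inE.
  rewrite -mean_sum -meanZ; apply: ler_mean => // x.
  rewrite -mulr_sumr mulrCA ler_wpM2l// exchange_big /=.
  (* For fixed i, at most f / (eps (3/2)^i) integer levels are cut below [f]; the ratio 2/3 sums to
     3. *)
  apply: (@le_trans _ _ (\sum_(i < M) f x / eps * (2 / 3) ^+ i)).
    apply: ler_sum => i _.
    have c0 : 0 < eps * (3 / 2) ^+ i by rewrite mulr_gt0// exprn_gt0//; lra.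
    apply: le_trans (count_multiples_lt N c0 (f0 x)) _.
    by rewrite invfM mulrA -exprVn invf_div.
  rewrite -mulr_sumr [leRHS]mulrAC mulrC [leRHS](_ : _ = 3 * (f x / eps)); last by ring.
  apply: ler_wpM2r; first by rewrite divr_ge0// ltW.
  apply: le_trans (geometric_sum_le M _ _) _; [lra|lra|].
  by rewrite le_eqVlt; apply/orP; left; apply/eqP; field.
have := le_trans lower upper.
have -> : 2 * T * (4 * eps * inner pi u u + 3 / eps * inner pi f f) =
    inner pi u u / 8 + 384 * T ^+ 2 * inner pi f f.
  by rewrite /eps; field; rewrite gt_eqF.
by lra.
Qed.

Lemma energy_bound u f : (forall x, 0 <= u x) ->
  (forall x, 0 <= f x) -> mass pi (superlevel u 0) <= 2^-1 ->
  (forall x, x \in superlevel u 0 -> u x - mapply P u x <= f x) ->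
  inner pi u u <= 3072 * T ^+ 2 * inner pi f f.
Proof.
move=> u0 f0 D0_half uf.
have [N uN] := finite_nat_bound (fun x => 4 / u x).
(* Scaling by [l] lifts every positive value of [u] to at least 4. Where [u] vanishes, 4 / u is 0 by
   convention and the scaled value is 0; the successor makes [l] positive. *)
pose l : R := N.+1%:R; have l0 : 0 < l by rewrite ltr0n.
have innerl h : inner pi (fun x => l * h x) (fun x => l * h x) = l ^+ 2 * inner pi h h.
  by rewrite /inner mulr_sumr; apply: eq_bigr => x _; ring.
have l2 : 0 < l ^+ 2 by rewrite exprn_gt0.
rewrite -(ler_pM2l l2) -innerl mulrCA -innerl.
have supp : superlevel (fun x => l * u x) 0 = superlevel u 0.
  by apply/setP => x; rewrite !inE pmulr_rgt0.
apply: energy_bound_gap => [x|x||x xD].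
- have [ux|ux] := ltP 0 (u x); [right|left].
    have := uN x; rewrite ler_pdivrMr// => /le_trans -> //.
    by rewrite ler_wpM2r// ler_nat.
  by rewrite (@le_anti _ _ (u x) 0) ?ux ?u0// mulr0.
- by rewrite mulr_ge0// ltW.
- by rewrite supp.
- by rewrite mapplyZ -mulrBr ler_pM2l// uf// -supp.
Qed.

(** Take the least value g y with at most half of the mass strictly above it. If g w is the next
    smaller value, more than half lies above g w, and this set is disjoint from {g < g y}. *)
Lemma median_exists g : exists m, mass pi [set x | m < g x]%SET <= 2^-1 /\
  mass pi [set x | g x < m]%SET <= 2^-1.
Proof.
have [_ pi1] := statP.1.
have [x0 _] : exists x0 : V, true.
  have [x _|V0] := pickP (@predT V); first by exists x.
  by move: pi1; rewrite big_pred0// => /esym/eqP; rewrite oner_eq0.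
have mass0 : mass pi finset.set0 = 0.
  by apply: big1 => x _; rewrite setind_out ?inE// mulr0.
pose top := [arg max_(x > x0) g x]%O.
have Ptop : mass pi [set x | g top < g x]%SET <= 2^-1.
  rewrite (_ : [set x | _]%SET = finset.set0) ?mass0 ?invr_ge0//.
  apply/setP => x; rewrite !inE /top; case: arg_maxP => //= y _ /(_ x isT).
  by rewrite leNgt => /negbTE.
case: (@arg_minP _ _ _ top (fun y => mass pi [set x | g y < g x]%SET <= 2^-1) g Ptop).
move=> /= y Py ymin; exists (g y); split=> //.
have [z zy|none] := pickP (fun z => g z < g y); last first.
  rewrite (_ : [set x | _]%SET = finset.set0) ?mass0 ?invr_ge0//.
  by apply/setP => x; rewrite !inE none.
case: (@arg_maxP _ _ _ z (fun x => g x < g y) g zy) => /= w wy wmax.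
have : 2^-1 < mass pi [set x | g w < g x]%SET.
  by rewrite ltNge; apply/negP => /ymin; rewrite leNgt wy.
suff : mass pi [set x | g w < g x]%SET + mass pi [set x | g x < g y]%SET <= 1 by lra.
rewrite -pi1 /mass /mean -big_split; apply: ler_sum => x _ /=.
rewrite -mulrDr -[leRHS]mulr1 ler_wpM2l// /setind !inE.
have [xy|_] := boolP (g x < g y); last by rewrite addr0 lern1 leq_b1.
by rewrite ltNge wmax// add0r.
Qed.

Lemma l2_poincare g : mean pi g = 0 ->
  inner pi g g <= 3072 * T ^+ 2 *
    inner pi (fun x => g x - mapply P g x) (fun x => g x - mapply P g x).
Proof.
move=> g0; have [m [above below]] := median_exists g.
have half h (c : R) : mass pi (superlevel h c) <= 2^-1 ->
    inner pi (pos_part_above h c) (pos_part_above h c) <= 3072 * T ^+ 2 *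
    inner pi (pos_part_above (fun x => h x - mapply P h x) 0)
             (pos_part_above (fun x => h x - mapply P h x) 0).
  move=> hc; have supp : superlevel (pos_part_above h c) 0 = superlevel h c.
    by apply/setP => x; rewrite !inE /pos_part_above lt_max ltxx orbF subr_gt0.
  apply: energy_bound => [x|x||x xD]; rewrite ?pos_part_above_ge0 ?supp//.
  apply: le_trans (pos_part_above_superharmonic sP _) _; first by rewrite -supp.
  by rewrite /pos_part_above subr0 le_max lexx.
have pos := half _ _ above.
have neg : inner pi (pos_part_above (fun x => - g x) (- m))
                    (pos_part_above (fun x => - g x) (- m)) <= 3072 * T ^+ 2 *
    inner pi (pos_part_above (fun x => - g x - mapply P (fun x => - g x) x) 0)
             (pos_part_above (fun x => - g x - mapply P (fun x => - g x) x) 0).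
  apply: half; rewrite (_ : superlevel _ _ = [set x | g x < m]%SET)//.
  by apply/setP => x; rewrite !inE ltrN2.
have sqr_split (a : R) : a ^+ 2 = Num.max a 0 ^+ 2 + Num.max (- a) 0 ^+ 2.
  have [a0|] := boolP (0 <= a).
    by rewrite (max_l a0) max_r ?oppr_le0// expr0n addr0.
  rewrite -ltNge => /ltW a0.
  by rewrite (max_r a0) max_l ?oppr_ge0// expr0n add0r sqrrN.
have inner_split (a b c : V -> R) : (forall x, b x = Num.max (a x) 0) ->
    (forall x, c x = Num.max (- a x) 0) ->
    inner pi a a = inner pi b b + inner pi c c.
  move=> eb ec; rewrite /inner -big_split; apply: eq_bigr => x _ /=.
  by rewrite -mulrDr -!expr2 sqr_split eb ec.
rewrite (inner_split (fun x => g x - mapply P g x)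
  (pos_part_above (fun x => g x - mapply P g x) 0)
  (pos_part_above (fun x => - g x - mapply P (fun x => - g x) x) 0)).
- rewrite mulrDr; apply: le_trans (lerD pos neg).
  rewrite -(inner_split (fun x => g x - m)).
  + rewrite [leRHS](_ : _ = inner pi g g - 2 * m * mean pi g + m ^+ 2 * mean pi (fun=> 1)).
      rewrite g0 mulr0 subr0 lerDl mulr_ge0 ?sqr_ge0//.
      by apply: sumr_ge0 => x _; rewrite mulr1.
    rewrite /inner /mean !mulr_sumr -sumrB -big_split /=.
    by apply: eq_bigr => x _; ring.
  + by move=> x.
  + by move=> x; rewrite /pos_part_above opprB opprK addrC.
- by move=> x; rewrite /pos_part_above subr0.
- move=> x; rewrite /pos_part_above subr0; congr Num.max.
  have -> : mapply P (fun x => - g x) x = - mapply P g x.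
    by rewrite -mulN1r -mapplyZ; apply: eq_bigr => y _; rewrite mulN1r.
  by rewrite opprB opprK addrC.
Qed.

End poincare.

(** * The geometric kernel *)

Section geometric_kernel.
Context {R : realType} {V : finType}.
Variables (P : V -> V -> R) (pi : V -> R) (t : R).
Implicit Types (f g h : V -> R) (D : {set V}).

Hypotheses (sP : stochastic P) (t_ge1 : 1 <= t).

Local Notation q := (1 - t^-1).
Local Notation K := (geom_kernel P t).

Let t_gt0 : 0 < t. Proof. exact: lt_le_trans t_ge1. Qed.

Let tV_ge0 : 0 <= t^-1. Proof. by rewrite invr_ge0 ltW. Qed.

Let q_ge0 : 0 <= q. Proof. by rewrite subr_ge0 invf_le1. Qed.

Let q_lt1 : q < 1. Proof. by rewrite ltrBlDr ltrDl invr_gt0. Qed.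

Let partial n x y := \sum_(m < n) mpow P m x y * (t^-1 * q ^+ m).

Lemma mpow_stochastic m : stochastic (mpow P m).
Proof.
elim: m => [|m IH] x; split=> [y|] /=.
- exact: ler0n.
- by rewrite (bigD1 x)//= eqxx big1 ?addr0// => y /negbTE; rewrite eq_sym => ->.
- by apply: sumr_ge0 => z _; rewrite mulr_ge0 ?(sP x).1 ?(IH z).1.
- rewrite exchange_big /= -(sP x).2; apply: eq_bigr => z _.
  by rewrite -mulr_sumr (IH z).2 mulr1.
Qed.

Lemma mpowSr m x y : mpow P m.+1 x y = \sum_z mpow P m x z * P z y.
Proof.
elim: m x y => [|m IH] x y /=.
  transitivity (P x y).
    by rewrite (bigD1 y)//= eqxx mulr1 big1 ?addr0// => z /negbTE ->; rewrite mulr0.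
  rewrite (bigD1 x)//= eqxx mul1r big1 ?addr0// => z /negbTE.
  by rewrite eq_sym => ->; rewrite mul0r.
under eq_bigr do rewrite -/(mpow P m.+1 _ _) IH mulr_sumr.
rewrite exchange_big; apply: eq_bigr => z _; rewrite mulr_suml.
by apply: eq_bigr => w _; rewrite mulrA.
Qed.

(** The terms are nonnegative and the partial sums are at most the total geometric weight 1, so the
    [limn] in the definition is a genuine limit. *)
Lemma geom_kernel_cvg x y : partial n x y @[n --> \oo] --> K x y.
Proof.
have -> : (fun n => partial n x y) =
    series (fun m => mpow P m x y * (t^-1 * q ^+ m)).
  by apply/funext => n; rewrite /series /= big_mkord.
have term0 m : 0 <= mpow P m x y * (t^-1 * q ^+ m).
  by rewrite !mulr_ge0 ?exprn_ge0// (mpow_stochastic m x).1.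
apply: nondecreasing_is_cvgn.
  by apply/nondecreasing_seqP => n; rewrite -subr_ge0 seriesSB.
exists 1 => _ [n _ <-]; rewrite /series /= big_mkord.
apply: (@le_trans _ _ (\sum_(m < n) t^-1 * q ^+ m)).
  apply: ler_sum => m _; rewrite ler_piMl ?mulr_ge0 ?exprn_ge0//.
  rewrite -((mpow_stochastic m x).2) (bigD1 y)//= lerDl sumr_ge0// => z _.
  exact: (mpow_stochastic m x).1.
rewrite -mulr_sumr; apply: le_trans (ler_wpM2l tV_ge0 (geometric_sum_le n q_ge0 q_lt1)) _.
by rewrite opprB addrC subrK invrK mulVf ?gt_eqF.
Qed.

(** Split off the term m = 0 and shift the series by one: this is the resolvent identity. *)
Lemma geom_kernel_left x y : K x y = t^-1 * (x == y)%:R + q * \sum_z P x z * K z y.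
Proof.
apply: (@cvg_unique _ (@Rhausdorff R) (partial n.+1 x y @[n --> \oo])).
  have := geom_kernel_cvg (x := x) (y := y).
  by rewrite -(cvg_shiftS (fun n => partial n x y)); apply.
rewrite /= (_ : (fun n => _) = (fun n =>
  t^-1 * (x == y)%:R + q * \sum_z P x z * partial n z y)).
  apply: cvgD; first exact: cvg_cst.
  apply: cvgMl_tmp; apply: cvg_sum => z; apply: cvgMl_tmp.
  exact: geom_kernel_cvg.
apply/funext => n; rewrite /partial big_ord_recl /= expr0 mulr1 mulrC; congr (_ + _).
under [in RHS]eq_bigr do rewrite mulr_sumr.
rewrite exchange_big mulr_sumr; apply: eq_bigr => m _.
rewrite mulr_suml mulr_sumr; apply: eq_bigr => z _.
by rewrite /bump /= add1n exprS; ring.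
Qed.

Lemma geom_kernel_right x y : K x y = t^-1 * (x == y)%:R + q * \sum_z K x z * P z y.
Proof.
apply: (@cvg_unique _ (@Rhausdorff R) (partial n.+1 x y @[n --> \oo])).
  have := geom_kernel_cvg (x := x) (y := y).
  by rewrite -(cvg_shiftS (fun n => partial n x y)); apply.
rewrite /= (_ : (fun n => _) = (fun n =>
  t^-1 * (x == y)%:R + q * \sum_z partial n x z * P z y)).
  apply: cvgD; first exact: cvg_cst.
  apply: cvgMl_tmp; apply: cvg_sum => z; apply: cvgMr_tmp.
  exact: geom_kernel_cvg.
apply/funext => n; rewrite /partial big_ord_recl /= expr0 mulr1 mulrC; congr (_ + _).
under [in RHS]eq_bigr do rewrite mulr_suml.
rewrite exchange_big mulr_sumr; apply: eq_bigr => m _.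
rewrite /bump /= add1n -/(mpow P m.+1 x y) mpowSr.
rewrite mulr_suml mulr_sumr; apply: eq_bigr => z _.
by rewrite exprS; ring.
Qed.

Lemma geom_kernel_ge0 x y : 0 <= K x y.
Proof.
rewrite -(cvg_lim (@Rhausdorff R) (geom_kernel_cvg (x := x) (y := y))).
apply: limr_ge; first by apply/cvg_ex; eexists; exact: geom_kernel_cvg.
apply: nearW => n; apply: sumr_ge0 => m _.
by rewrite !mulr_ge0 ?exprn_ge0// (mpow_stochastic m x).1.
Qed.

(** As 1 - q = 1/t is nonzero, the resolvent equation has a unique solution. Row sums and the action
    on [pi] are thus read off without summing the series. *)
Let resolvent_eq1 (r a : R) : r = t^-1 * a + q * r -> r = a.
Proof.
move=> H; have : t^-1 * r = t^-1 * a by lra.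
by apply: mulfI; rewrite invr_eq0 gt_eqF.
Qed.

Lemma sum_delta f x : \sum_y (x == y)%:R * f y = f x.
Proof.
rewrite (bigD1 x)//= eqxx mul1r big1 ?addr0// => y /negbTE.
by rewrite eq_sym => ->; rewrite mul0r.
Qed.

Lemma geom_kernel_stochastic : stochastic K.
Proof.
move=> x; split=> [y|]; first exact: geom_kernel_ge0.
apply: resolvent_eq1; under [LHS]eq_bigr do rewrite geom_kernel_right.
rewrite big_split /= -!mulr_sumr; congr (_ * _ + q * _).
  by under eq_bigr do rewrite -[_%:R]mulr1; rewrite sum_delta.
rewrite exchange_big; apply: eq_bigr => z _ /=.
by rewrite -mulr_sumr (sP z).2 mulr1.
Qed.

Lemma geom_kernel_stationary : stationary P pi -> stationary K pi.
Proof.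
move=> [pidist piP]; split=> // y.
apply: resolvent_eq1; under [LHS]eq_bigr do rewrite geom_kernel_left mulrDr.
rewrite big_split /=; congr (_ + _).
  under eq_bigr do rewrite mulrCA eq_sym [pi _ * _]mulrC.
  by rewrite -mulr_sumr sum_delta.
under eq_bigr do rewrite mulrCA mulr_sumr.
rewrite -mulr_sumr exchange_big; congr (_ * _); apply: eq_bigr => z _ /=.
by rewrite -piP mulr_suml; apply: eq_bigr => x _; rewrite mulrA.
Qed.

Lemma mapply_geom_kernel_left f x :
  mapply K f x = t^-1 * f x + q * mapply P (mapply K f) x.
Proof.
rewrite /mapply; under [LHS]eq_bigr do rewrite geom_kernel_left mulrDl -!mulrA.
rewrite big_split /= -!mulr_sumr sum_delta; congr (_ + _ * _).
under [LHS]eq_bigr do rewrite mulr_suml.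
rewrite exchange_big; apply: eq_bigr => z _; rewrite mulr_sumr.
by apply: eq_bigr => y _; rewrite mulrA.
Qed.

Lemma mapply_geom_kernel_right f x :
  mapply K f x = t^-1 * f x + q * mapply K (mapply P f) x.
Proof.
rewrite /mapply; under [LHS]eq_bigr do rewrite geom_kernel_right mulrDl -!mulrA.
rewrite big_split /= -!mulr_sumr sum_delta; congr (_ + _ * _).
under [LHS]eq_bigr do rewrite mulr_suml.
rewrite exchange_big; apply: eq_bigr => z _; rewrite mulr_sumr.
by apply: eq_bigr => y _; rewrite mulrA.
Qed.

End geometric_kernel.

(** * The operator norm on L^2(pi) *)

Section operator_norm.
Context {R : realType} {V : finType}.
Variable pi : V -> R.
Implicit Types (f g : V -> R) (M : V -> V -> R).

Hypothesis pi_gt0 : forall x, 0 < pi x.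

Let pi_ge0 x : 0 <= pi x. Proof. exact: ltW. Qed.

Lemma l2normE f : l2norm pi f = Num.sqrt (inner pi f f).
Proof. by congr Num.sqrt; apply: eq_bigr => x _; rewrite expr2. Qed.

(** The Hilbert-Schmidt bound: each value of M f is an inner product of [f] with a row of [M]
    divided by [pi]. Boundedness makes the [sup] in [opnorm] meaningful. *)
Lemma opnorm_has_ub M :
  has_ubound [set l2norm pi (mapply M f) | f in [set f | l2norm pi f = 1]].
Proof.
pose a x y := M x y / pi y.
exists (Num.sqrt (mean pi (fun x => inner pi (a x) (a x)))) => _ [f /= f1 <-].
have ff1 : inner pi f f = 1.
  by rewrite -[LHS]sqr_sqrtr ?inner_ge0// -l2normE f1 expr1n.
rewrite l2normE ler_wsqrtr//; apply: ler_mean => // x; rewrite -expr2.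
have -> : mapply M f x = inner pi (a x) f.
  by apply: eq_bigr => y _; rewrite /a; field; rewrite gt_eqF.
by apply: le_trans (inner_CauchySchwarz _ _ pi_ge0) _; rewrite ff1 mulr1.
Qed.

Lemma opnorm_le_inner M (delta : R) f : 0 <= delta -> opnorm pi M <= delta ->
  inner pi (mapply M f) (mapply M f) <= delta ^+ 2 * inner pi f f.
Proof.
move=> d0 Md; have ff0 := inner_ge0 f pi_ge0.
have innerZ (c : R) h : inner pi (fun x => c * h x) (fun x => c * h x) = c ^+ 2 * inner pi h h.
  by rewrite /inner mulr_sumr; apply: eq_bigr => x _; ring.
have [ff|ff_le0] := ltP 0 (inner pi f f); last first.
  have f_eq0 x : f x = 0.
    have ffe : inner pi f f = 0 by apply: le_anti; rewrite ff_le0 ff0.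
    have ff_ge0 y : true -> 0 <= pi y * (f y * f y).
      by rewrite mulr_ge0// -expr2 sqr_ge0.
    have /(_ x isT)/eqP := psumr_eq0P ff_ge0 ffe.
    by rewrite mulf_eq0 gt_eqF//= mulf_eq0 orbb => /eqP.
  rewrite [leLHS]big1 ?mulr_ge0 ?sqr_ge0// => x _.
  by rewrite {1}/mapply big1 ?mul0r ?mulr0// => y _; rewrite f_eq0 mulr0.
pose c := (l2norm pi f)^-1; pose g x := c * f x.
have n0 : 0 < l2norm pi f by rewrite l2normE sqrtr_gt0.
have n2 : l2norm pi f ^+ 2 = inner pi f f by rewrite l2normE sqr_sqrtr.
have g1 : l2norm pi g = 1.
  by rewrite l2normE innerZ -n2 /c -exprMn mulVf ?gt_eqF// expr1n sqrtr1.
have : l2norm pi (mapply M g) <= delta.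
  by apply: le_trans Md; apply: ub_le_sup; [exact: opnorm_has_ub|exists g].
rewrite l2normE (_ : mapply M g = (fun x => c * mapply M f x)); last first.
  by apply/funext => x; rewrite mapplyZ.
rewrite innerZ -(@ler_pXn2r R 2)// ?nnegrE ?sqrtr_ge0//.
rewrite sqr_sqrtr; last by apply: mulr_ge0; [exact: sqr_ge0|exact: inner_ge0].
by rewrite /c exprVn n2 ler_pdivrMl// mulrC.
Qed.

Lemma opnorm_le M (delta : R) : \sum_x pi x = 1 ->
  (forall f, inner pi f f = 1 ->
     inner pi (mapply M f) (mapply M f) <= delta ^+ 2) -> 0 <= delta ->
  opnorm pi M <= delta.
Proof.
move=> pi1 H d0; apply: ge_sup.
  (* The constant 1 has norm 1, so the supremum is over a nonempty set. *)
  exists (l2norm pi (mapply M (fun=> 1))), (fun=> 1) => //=.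
  rewrite l2normE /inner; under eq_bigr do rewrite !mulr1.
  by rewrite pi1 sqrtr1.
move=> _ [f /= f1 <-]; rewrite l2normE -[leRHS]ger0_norm// -sqrtr_sqr ler_wsqrtr//.
by apply: H; rewrite -[LHS]sqr_sqrtr ?inner_ge0// -l2normE f1 expr1n.
Qed.

End operator_norm.

(** * Hitting times against the geometric relaxation time *)

Section relaxation.
Context {R : realType} {V : finType}.
Variables (P : V -> V -> R) (pi : V -> R).
Implicit Types (f g h : V -> R) (D : {set V}).

Hypotheses (sP : stochastic P) (statP : stationary P pi).
Hypothesis pi_gt0 : forall x, 0 < pi x.

Let pi_ge0 x : 0 <= pi x. Proof. exact: ltW. Qed.

Let pi1 : \sum_x pi x = 1. Proof. by have [[]] := statP. Qed.

Definition deviation K : V -> V -> R := fun x y => K x y - pi y.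

Lemma mapply_deviation K f x : mapply (deviation K) f x = mapply K f x - mean pi f.
Proof.
by rewrite /mapply /mean -sumrB; apply: eq_bigr => y _; rewrite mulrBl.
Qed.

Lemma mean_mapply K f : stationary K pi -> mean pi (mapply K f) = mean pi f.
Proof.
move=> [_ piK]; rewrite /mean; under eq_bigr do rewrite mulr_sumr.
rewrite exchange_big; apply: eq_bigr => y _ /=.
by rewrite -piK mulr_suml; apply: eq_bigr => x _; rewrite mulrA.
Qed.

Lemma mean_cst (c : R) : mean pi (fun=> c) = c.
Proof. by rewrite /mean -mulr_suml pi1 mul1r. Qed.

Lemma meanB f (c : R) : mean pi (fun x => f x - c) = mean pi f - c.
Proof.
rewrite -[in RHS](mean_cst c) /mean -sumrB.
by apply: eq_bigr => x _; rewrite mulrBr.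
Qed.

Lemma inner_centered f (c : R) :
  inner pi (fun x => f x - c) (fun x => f x - c) =
  inner pi f f - 2 * c * mean pi f + c ^+ 2.
Proof.
rewrite -[in RHS](mean_cst (c ^+ 2)) /inner /mean mulr_sumr -sumrB -big_split /=.
by apply: eq_bigr => x _; ring.
Qed.

Lemma mapply_deviation_centered K f x : stochastic K ->
  mapply (deviation K) (fun x => f x - mean pi f) x = mapply (deviation K) f x.
Proof.
move=> sK; rewrite !mapply_deviation meanB subrr subr0.
by rewrite mapplyD (mapply_cst (- _) x sK).
Qed.

(** With m = mean f, the energy of K f is m^2 plus that of its centred part, hence at most m^2 +
    delta^2 (F - m^2), where F is the energy of [f]. Cauchy-Schwarz on [D] gives m^2 <= F / 2. *)
Lemma inner_mapply_le K D f (delta : R) : stochastic K -> stationary K pi ->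
  0 <= delta -> delta <= 1 -> opnorm pi (deviation K) <= delta ->
  mass pi D <= 2^-1 -> (forall x, x \notin D -> f x = 0) ->
  inner pi (mapply K f) (mapply K f) <= (1 + delta ^+ 2) / 2 * inner pi f f.
Proof.
move=> sK statK d0 d1 Kd D_half fout.
have small : mean pi f ^+ 2 <= 2^-1 * inner pi f f.
  rewrite -(inner_setind_mean pi fout).
  apply: le_trans (inner_CauchySchwarz _ _ pi_ge0) _.
  apply: ler_wpM2r; first exact: inner_ge0.
  by rewrite inner_setind_mean// => x; exact: setind_out.
have contract := opnorm_le_inner pi_gt0 (fun x => f x - mean pi f) d0 Kd.
move: contract; rewrite (_ : mapply (deviation K) _ = (fun x => mapply K f x - mean pi f)).
  rewrite !inner_centered mean_mapply// => contract.
  have d2 : delta ^+ 2 <= 1 by rewrite expr_le1.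
  have d2' : 0 <= delta ^+ 2 by rewrite sqr_ge0.
  have m2 : 0 <= mean pi f ^+ 2 by rewrite sqr_ge0.
  move: small contract m2 d2 d2'.
  set m := mean pi f; set F := inner pi f f; set G := inner pi _ _.
  by move: (delta ^+ 2) => d; nra.
by apply/funext => x; rewrite mapply_deviation_centered// mapply_deviation.
Qed.

Lemma mean_trunc_hits_le D (t delta : R) N : 1 <= t -> 0 <= delta -> delta < 1 ->
  opnorm pi (deviation (geom_kernel P t)) <= delta -> mass pi D <= 2^-1 ->
  (1 - Num.sqrt ((1 + delta ^+ 2) / 2)) * mean pi (trunc_hits P D N) <= t * mass pi D.
Proof.
move=> t1 d0 d1 Kd D_half; set K := geom_kernel P t in Kd.
have sK : stochastic K by exact: geom_kernel_stochastic.
have statK : stationary K pi by exact: geom_kernel_stationary.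
set b := (1 + delta ^+ 2) / 2; set h := trunc_hits P D N.
have t0 : 0 < t by exact: lt_le_trans t1.
have h0 x : 0 <= h x by exact: trunc_hits_ge0.
have hout x : x \notin D -> h x = 0 by exact: trunc_hits_out.
have hP x : h x - 1 <= mapply P h x.
  have Ph0 : 0 <= mapply P h x by exact: mapply_ge0.
  have [xD|xD] := boolP (x \in D); last by rewrite hout//; lra.
  by have := trunc_hits_le D N x sP; rewrite trunc_hitsS setind_in// mul1r -/h; lra.
(* Solving the resolvent identity for h gives h = t K h - (t - 1) K P h, and K P h >= K h - 1. *)
have hK x : h x <= mapply K h x + (t - 1).
  have := mapply_geom_kernel_right sP t1 h x; rewrite -/K => Kh.
  have : mapply K h x - 1 <= mapply K (mapply P h) x.
    rewrite [leLHS](_ : _ = mapply K (fun x => h x + -1) x); last first.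
      by rewrite mapplyD (mapply_cst (-1) x sK).
    exact: ler_mapply.
  have -> : h x = t * mapply K h x - (t - 1) * mapply K (mapply P h) x.
    by rewrite {1}Kh; field; rewrite gt_eqF.
  by move: t1; set a := mapply K h x; set c := mapply K _ x; nra.
have normK : inner pi h (mapply K h) <= Num.sqrt b * inner pi h h.
  have hh0 := inner_ge0 h pi_ge0.
  have b0 : 0 <= b by rewrite divr_ge0// addr_ge0// sqr_ge0.
  have rhs0 : 0 <= Num.sqrt b * inner pi h h by rewrite mulr_ge0// sqrtr_ge0.
  apply: le_trans (ler_norm _) _; rewrite -(@ler_pXn2r R 2)// ?nnegrE//.
  rewrite real_normK ?num_real// exprMn sqr_sqrtr//.
  apply: le_trans (inner_CauchySchwarz _ _ pi_ge0) _.
  rewrite [leRHS](_ : _ = inner pi h h * (b * inner pi h h)); last by ring.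
  by apply: ler_wpM2l => //; apply: (inner_mapply_le sK statK d0 (ltW d1) Kd D_half hout).
have energy : (1 - Num.sqrt b) * inner pi h h <= (t - 1) * mean pi h.
  have : inner pi h h <= inner pi h (fun x => mapply K h x + (t - 1)).
    by apply: ler_inner.
  rewrite innerDr (_ : inner pi h (fun=> t - 1) = (t - 1) * mean pi h); last first.
    by rewrite -meanZ; apply: eq_bigr => x _; rewrite (mulrC (h x)).
  by lra.
have CS : mean pi h ^+ 2 <= mass pi D * inner pi h h.
  rewrite -(inner_setind_mean pi hout).
  apply: le_trans (inner_CauchySchwarz _ _ pi_ge0) _.
  by rewrite inner_setind_mean// => x; exact: setind_out.
have D0 : 0 <= mass pi D by apply: sumr_ge0 => x _; rewrite mulr_ge0// ler0n.
have m0 : 0 <= mean pi h by apply: sumr_ge0 => x _; rewrite mulr_ge0.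
(* Combining [CS] and [energy] bounds the square of the mean by a multiple of the mean, so one
   factor must be cancelled. *)
have [m_gt0|m_le0] := ltP 0 (mean pi h); last first.
  by rewrite (@le_anti _ _ (mean pi h) 0) ?m0 ?m_le0// mulr0 mulr_ge0// ltW.
have c_gt0 : 0 < 1 - Num.sqrt b.
  rewrite subr_gt0 -[ltRHS]sqrtr1 ltr_sqrt// /b.
  have : delta ^+ 2 < 1 by rewrite expr_lt1.
  by lra.
rewrite -(ler_pM2r m_gt0).
have H1 := ler_wpM2l (ltW c_gt0) CS.
have H2 := ler_wpM2l D0 energy.
move: m_gt0 D0 H1 H2; set m := mean pi h; set D_ := mass pi D; set c := 1 - _.
by set H := inner pi h h; nra.
Qed.

Lemma expRN1_ge : 4^-1 <= (expR 1)^-1 :> R.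
Proof.
rewrite -expRN; have -> : -1 = - 2^-1 + - 2^-1 :> R by field.
by rewrite expRD; have := expR_ge1Dx (- 2^-1 : R); nra.
Qed.

(** The factor 401 gives t - 1 >= 400 T, so G <= (3072 / 160000) (2 + 2 G) for the energy G of [g].
    Hence G <= 1/16, which is at most e^-2 because e <= 4. *)
Lemma opnorm_geom_kernel_le (T : R) : 1 <= T -> quick_hits P pi T ->
  opnorm pi (deviation (geom_kernel P (401 * T))) <= (expR 1)^-1.
Proof.
move=> T1 quickP; set t := 401 * T; set K := geom_kernel P t.
have t1 : 1 <= t by rewrite /t; lra.
have t0 : 0 < t by exact: lt_le_trans t1.
have T0 : 0 < T by exact: lt_le_trans T1.
have sK : stochastic K by exact: geom_kernel_stochastic.
have statK : stationary K pi by exact: geom_kernel_stationary.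
apply: opnorm_le => // f ff1.
pose f0 x := f x - mean pi f; pose g := mapply K f0.
have gE : mapply (deviation K) f = g.
  apply/funext => x; rewrite -mapply_deviation_centered// mapply_deviation.
  by rewrite meanB subrr subr0.
have g0 : mean pi g = 0 by rewrite mean_mapply// meanB subrr.
have ff0 : inner pi f0 f0 <= 1.
  by rewrite inner_centered ff1; have := sqr_ge0 (mean pi f); lra.
have := l2_poincare sP statP pi_gt0 T0 quickP g0.
rewrite gE; set L := inner pi (fun x => g x - _) _; set G := inner pi g g => poinc.
have gap : (t - 1) ^+ 2 * L <= 2 * inner pi f0 f0 + 2 * G.
  rewrite /L /G /inner !mulr_sumr -big_split; apply: ler_sum => x _ /=.
  have geq : (t - 1) * (g x - mapply P g x) = f0 x - g x.
    have := mapply_geom_kernel_left sP t1 f0 x; rewrite -/K -/g => geq.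
    have : t * g x = f0 x + (t - 1) * mapply P g x.
      by rewrite {1}geq; field; rewrite gt_eqF.
    by lra.
  rewrite [leLHS](_ : _ = pi x * ((t - 1) * (g x - mapply P g x)) ^+ 2); last by ring.
  rewrite geq [leRHS](_ : _ = pi x * (2 * f0 x ^+ 2 + 2 * g x ^+ 2)); last by ring.
  by apply: ler_wpM2l => //; have := sqr_ge0 (f0 x + g x); lra.
have L0 : 0 <= L by exact: inner_ge0.
have t2 : (400 * T) ^+ 2 <= (t - 1) ^+ 2.
  by rewrite ler_pXn2r// ?nnegrE /t; lra.
have HL := ler_wpM2r L0 t2.
have HG : G <= 16^-1.
  rewrite exprMn in HL.
  move: poinc gap HL ff0; rewrite -mulrA; set TL := T ^+ 2 * L.
  rewrite -[400 ^+ 2 * _ * _]mulrA -/TL.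
  by set X := (t - 1) ^+ 2 * L; set F := inner pi f0 f0; lra.
apply: le_trans HG _.
have := expRN1_ge; set e := (expR 1)^-1; nra.
Qed.

End relaxation.

(** * Hitting times *)

Section hitting_times.
Context {R : realType} {V : finType} {d : measure_display}
  {Omega : measurableType d}.
Implicit Types (P : V -> V -> R) (mu pi : V -> R) (X : nat -> Omega -> V)
  (Pr : probability Omega R) (D : {set V}).

Lemma measure_partition (Pr : probability Omega R) (Y : Omega -> V) (E : set Omega) :
  measurable E -> (forall y, measurable [set w | Y w = y]) ->
  Pr E = (\sum_y Pr (E `&` [set w | Y w = y]))%E.
Proof.
move=> mE mY.
have {1}-> : E = \bigcup_(y in [set` index_enum V]) (E `&` [set w | Y w = y]).
  apply/seteqP; split=> [w Ew|w [y _ []]//].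
  by exists (Y w) => //=; rewrite mem_index_enum.
rewrite measure_fin_bigcup//; first by rewrite -fsbig_seq ?index_enum_uniq.
- by move=> y z _ _ [w [[_ yw] [_ zw]]]; exact: etrans (esym yw) zw.
- by move=> y _; exact: measurableI.
Qed.

Lemma measurable_forall_le (n : nat) (E : nat -> set Omega) :
  (forall i, measurable (E i)) -> measurable [set w | forall i, (i <= n)%N -> E i w].
Proof. by move=> mE; apply: (@bigcap_measurable _ _ E [set i | (i <= n)%N]) => //; exists 0%N. Qed.

Lemma measurable_in_set (Y : Omega -> V) D :
  (forall y, measurable [set w | Y w = y]) -> measurable [set w | Y w \in D].
Proof.
move=> mY; rewrite (_ : mkset _ = \bigcup_(y in [set y | y \in D]) [set w | Y w = y]).
  by apply: fin_bigcup_measurable => //; exact: finite_finset.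
by apply/seteqP; split=> [w wD|w [y /= yD Yw]]; [exists (Y w)|rewrite /mkset Yw].
Qed.

(** The Markov property is given for fully prescribed paths, so the induction on [k] keeps [n] and
    [s] general and lengthens the prescribed path by one state. *)
Lemma path_then_stay P mu Pr X D k n (s : nat -> V) : stochastic P ->
  markov_chain P mu Pr X ->
  Pr [set w | (forall i, (i <= n)%N -> X i w = s i) /\
              (forall i, (i <= k)%N -> X (n + i)%N w \in D)] =
  (Pr [set w | forall i, (i <= n)%N -> X i w = s i] * (survival P D k (s n))%:E)%E.
Proof.
move=> sP [mX _ markov].
have mpath m (r : nat -> V) : measurable [set w | forall i, (i <= m)%N -> X i w = r i].
  by exact: (@measurable_forall_le m (fun i => [set w | X i w = r i])).
have mstay m j : measurable [set w | forall i, (i <= j)%N -> X (m + i)%N w \in D].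
  apply: (@measurable_forall_le j (fun i => [set w | X (m + i)%N w \in D])) => i.
  exact: measurable_in_set.
elim: k n s => [|k IH] n s.
  have [sD|sD] := boolP (s n \in D).
    rewrite /= setind_in// mule1; congr (Pr _); apply/seteqP; split=> w /=.
      by case.
    by move=> Xs; split=> // i; rewrite leqn0 => /eqP ->; rewrite addn0 Xs.
  rewrite /= setind_out// mule0 (_ : mkset _ = set0) ?measure0//.
  apply/seteqP; split=> // w [/(_ n (leqnn n)) Xn /(_ 0%N isT)].
  by rewrite addn0 Xn (negbTE sD).
have [sD|sD] := boolP (s n \in D); last first.
  rewrite /= setind_out// mul0r mule0 (_ : mkset _ = set0) ?measure0//.
  apply/seteqP; split=> // w [/(_ n (leqnn n)) Xn /(_ 0%N isT)].
  by rewrite addn0 Xn (negbTE sD).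
rewrite (@measure_partition Pr (X n.+1)) /=; last 2 first.
- exact: (measurableI _ _ (mpath n s) (mstay n k.+1)).
- exact: mX.
pose ext y i := if (i <= n)%N then s i else y.
have step y : Pr ([set w | (forall i, (i <= n)%N -> X i w = s i) /\
      (forall i, (i <= k.+1)%N -> X (n + i)%N w \in D)] `&` [set w | X n.+1 w = y]) =
    (Pr [set w | forall i, (i <= n)%N -> X i w = s i] *
       (P (s n) y * survival P D k y)%:E)%E.
  have extS : ext y n.+1 = y by rewrite /ext ltnn.
  have extn : ext y n = s n by rewrite /ext leqnn.
  transitivity (Pr [set w | (forall i, (i <= n.+1)%N -> X i w = ext y i) /\
      (forall i, (i <= k)%N -> X (n.+1 + i)%N w \in D)]).
    congr (Pr _); apply/seteqP; split=> w /=.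
      move=> [[Xs XD] Xy]; split=> i; last by rewrite addSnnS => ik; exact: XD.
      rewrite leq_eqVlt ltnS => /orP[/eqP->|ile]; first by rewrite extS.
      by rewrite /ext ile Xs.
    move=> [Xs XD]; split; last by rewrite Xs// extS.
    split=> [i ile|[_|i ik]].
    - by rewrite Xs ?leqW// /ext ile.
    - by rewrite addn0 Xs// extn.
    - by rewrite addnS -addSn XD.
  rewrite IH extS markov extS extn EFinM muleA; congr (Pr _ * _ * _)%E.
  apply/seteqP; split=> w /= Xs i ile; first by rewrite Xs// /ext ile.
  by rewrite Xs// /ext ile.
under eq_bigr do rewrite step.
rewrite -ge0_sume_distrr ?sumEFin; last first.
  move=> y _; rewrite lee_fin mulr_ge0 ?survival_ge0//.
  exact: (sP (s n)).1.
by rewrite setind_in// mul1r.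
Qed.

Lemma stay_probability P mu Pr X D k : stochastic P -> markov_chain P mu Pr X ->
  Pr [set w | forall i, (i <= k)%N -> X i w \in D] =
  (\sum_x mu x * survival P D k x)%:E.
Proof.
move=> sP markovX; have [mX X0 _] := markovX.
rewrite (@measure_partition Pr (X 0%N)); last 2 first.
- apply: (@measurable_forall_le k (fun i => [set w | X i w \in D])) => i.
  exact: measurable_in_set.
- exact: mX.
rewrite -sumEFin; apply: eq_bigr => x _; rewrite EFinM -X0.
have := @path_then_stay P mu Pr X D k 0 (fun=> x) sP markovX.
rewrite (_ : [set w | forall i, (i <= 0)%N -> X i w = x] = [set w | X 0%N w = x]).
  move=> <-; congr (Pr _); apply/seteqP; split=> w /=.
    by move=> [XD Xx]; split=> // i; rewrite leqn0 => /eqP ->.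
  by move=> [Xx XD]; split=> //; exact: Xx.
apply/seteqP; split=> w /=; first exact.
by move=> Xx i; rewrite leqn0 => /eqP ->.
Qed.

(** The pathwise tail-sum formula, the k-th indicator being that of hitting after time k. If [A] is
    never hit, both sides are infinite. *)
Lemma hitting_time_nneseries X A w : hitting_time (R := R) X A w =
  (\sum_(0 <= k <oo) (\1_[set w | forall i, (i <= k)%N -> X i w \in ~: A] w)%:E)%E.
Proof.
set stay := fun k => [set w | forall i, (i <= k)%N -> X i w \in ~: A].
have ind0 k : (0 <= (\1_(stay k) w)%:E :> \bar R)%E by rewrite lee_fin indicE ler0n.
have partial n : (forall k, (k < n)%N -> X k w \notin A) ->
    (n%:R%:E <= \sum_(0 <= k <oo) (\1_(stay k) w)%:E :> \bar R)%E.
  move=> out; apply: le_trans (nneseries_lim_ge n (fun k _ _ => ind0 k)).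
  rewrite sumEFin lee_fin big_mkord (eq_bigr (fun=> 1)).
    by rewrite sumr_const card_ord.
  move=> k _; rewrite indicE mem_set// => i ik; rewrite inE.
  by apply: out; exact: leq_ltn_trans ik _.
apply/eqP; rewrite eq_le; apply/andP; split.
  have [hit|nohit] := pselect (exists m, X m w \in A).
    have [m Xm mmin] := ex_minnP hit.
    apply: (@le_trans _ _ m%:R%:E); first by apply: ereal_inf_lbound; exists m.
    by apply: partial => k; apply: contraTN => /mmin; rewrite -leqNgt.
  rewrite [leRHS](_ : _ = +oo%E) ?leey//; apply: eq_infty => r.
  apply: le_trans (partial (Num.bound `|r|) _); last first.
    by move=> k _; apply/negP => Xk; apply: nohit; exists k.
  rewrite lee_fin; apply: le_trans (ler_norm _) _.
  exact: ltW (archi_boundP (normr_ge0 _)).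
apply: le_ereal_inf_tmp => _ [m /= Xm <-].
apply: lime_le; first exact: is_cvg_nneseries.
apply: nearW => n; rewrite big_mkord sumEFin lee_fin.
have count_lt : (\sum_(k < n) (k < m)%N <= minn n m)%N.
  elim: n => [|n IH]; first by rewrite big_ord0.
  rewrite big_ord_recr /=; move: IH; rewrite !leq_min => /andP[Sn Sm].
  case: (ltnP n m) => nm; rewrite ?addn1 ?addn0 ?ltnS ?Sn ?Sm ?(leqW Sn)//=.
  exact: leq_ltn_trans Sn nm.
apply: (@le_trans _ _ (\sum_(k < n) (k < m)%N)%:R); last first.
  by rewrite ler_nat; move: count_lt; rewrite leq_min => /andP[].
rewrite natr_sum; apply: ler_sum => k _; rewrite indicE ler_nat.
have [//|mk] := ltnP k m; first by rewrite leq_b1.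
by rewrite memNset// => /(_ m mk); rewrite inE Xm.
Qed.

Lemma expected_hitting_time P mu Pr X A : stochastic P -> markov_chain P mu Pr X ->
  (\int[Pr]_w hitting_time X A w)%E =
  (\sum_(0 <= k <oo) (\sum_x mu x * survival P (~: A) k x)%:E)%E.
Proof.
move=> sP markovX; have [mX _ _] := markovX.
have mstay k : measurable [set w | forall i, (i <= k)%N -> X i w \in ~: A].
  apply: (@measurable_forall_le k (fun i => [set w | X i w \in ~: A])) => i.
  exact: measurable_in_set.
under eq_integral do rewrite hitting_time_nneseries.
rewrite integral_nneseries//.
- apply: eq_eseriesr => k _; rewrite integral_indic// setIT.
  exact: stay_probability.
- by move=> k; apply/measurable_EFinP; exact: measurable_indic.
Qed.

Lemma sum_survival_mean P mu D N :
  \sum_(k < N) (\sum_x mu x * survival P D k x) = mean mu (trunc_hits P D N).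
Proof. by rewrite -mean_sum. Qed.

Lemma expected_hitting_time_ge P mu Pr X A N : stochastic P ->
  distribution_on mu -> markov_chain P mu Pr X ->
  ((mean mu (trunc_hits P (~: A) N))%:E <= \int[Pr]_w hitting_time X A w)%E.
Proof.
move=> sP [mu0 _] markovX; rewrite (expected_hitting_time _ sP markovX).
apply: le_trans (nneseries_lim_ge N _).
  by rewrite big_mkord sumEFin sum_survival_mean.
move=> k _ _; rewrite lee_fin sumr_ge0// => x _.
by rewrite mulr_ge0// survival_ge0.
Qed.

Lemma expected_hitting_time_le P mu Pr X A (B : R) : stochastic P ->
  distribution_on mu -> markov_chain P mu Pr X ->
  (forall N, mean mu (trunc_hits P (~: A) N) <= B) ->
  (\int[Pr]_w hitting_time X A w <= B%:E)%E.
Proof.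
move=> sP [mu0 _] markovX bdd; rewrite (expected_hitting_time _ sP markovX).
apply: lime_le.
  apply: is_cvg_nneseries => k _ _; rewrite lee_fin sumr_ge0// => x _.
  by rewrite mulr_ge0// survival_ge0.
by apply: nearW => n; rewrite big_mkord sumEFin lee_fin sum_survival_mean.
Qed.

End hitting_times.

(** * Positivity of pi and restricted distributions *)

Section chain.
Context {R : realType} {V : finType}.
Variables (P : V -> V -> R) (pi : V -> R).

(** Some state carries mass, and invariance under the powers of [P] spreads it to every state by
    irreducibility. *)
Lemma stationary_gt0 : stochastic P -> irreducible P -> stationary P pi ->
  forall x, 0 < pi x.
Proof.
move=> sP irr [[pi0 pi1] piP] y.
have [x pix] : exists x, 0 < pi x.
  apply/not_existsP => H; have : \sum_x pi x <= 0.
    by apply: sumr_le0 => x _; rewrite leNgt; apply/negP; exact: H.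
  by rewrite pi1 ler10.
have pim m : \sum_z pi z * mpow P m z y = pi y.
  elim: m => [|m IH] /=.
    by under eq_bigr do rewrite eq_sym mulrC; rewrite sum_delta.
  under eq_bigr do rewrite mulr_sumr.
  rewrite exchange_big -[RHS]IH; apply: eq_bigr => z _ /=.
  by rewrite -piP mulr_suml; apply: eq_bigr => w _; rewrite mulrA.
have [m xmy] := irr x y.
rewrite -(pim m) (bigD1 x)//= ltr_pwDl ?mulr_gt0//.
by apply: sumr_ge0 => z _; rewrite mulr_ge0// (mpow_stochastic sP m z).1.
Qed.

Lemma massE (D : {set V}) : mass pi D = \sum_(x in D) pi x.
Proof.
rewrite /mass /mean [RHS]big_mkcond; apply: eq_bigr => x _.
by rewrite /setind; case: (x \in D); rewrite ?mulr1 ?mulr0.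
Qed.

Lemma mass_gt0 (D : {set V}) x : (forall y, 0 < pi y) -> x \in D -> 0 < mass pi D.
Proof.
move=> pi_gt0 xD; rewrite massE (bigD1 x)//= ltr_pwDl//.
by apply: sumr_ge0 => y _; exact: ltW.
Qed.

Lemma restrict_dist_distribution (D : {set V}) : (forall x, 0 <= pi x) ->
  0 < mass pi D -> distribution_on (restrict_dist pi D).
Proof.
move=> pi0 D0; split=> [x|]; rewrite /restrict_dist -massE.
  by case: ifP => // _; rewrite divr_ge0// ltW.
by rewrite -big_mkcond /= -mulr_suml -massE divff// gt_eqF.
Qed.

Lemma mean_restrict_dist (D : {set V}) h : (forall x, x \notin D -> h x = 0) ->
  mean (restrict_dist pi D) h = mean pi h / mass pi D.
Proof.
move=> hout; rewrite /mean mulr_suml; apply: eq_bigr => x _.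
rewrite /restrict_dist -massE; case: ifPn => [_|/hout->]; last by rewrite !mulr0 mul0r.
by rewrite mulrAC.
Qed.

End chain.

(** * Two-sided control of t_H *)

Section bounds.
Context {R : realType} {V : finType} {d : measure_display}
  {Omega : measurableType d}.
Variables (P : V -> V -> R) (pi : V -> R).
Variables (Prob : (V -> R) -> probability Omega R) (X : nat -> Omega -> V).

Hypotheses (sP : stochastic P) (statP : stationary P pi).
Hypothesis pi_gt0 : forall x, 0 < pi x.
Hypothesis markovX : markov_family P Prob X.

Let pi_ge0 x : 0 <= pi x. Proof. exact: ltW. Qed.

Lemma massC (D : {set V}) : mass pi D + mass pi (~: D) = 1.
Proof.
have [[_ <-] _] := statP; rewrite !massE [RHS](bigID [in D]) /=; congr (_ + _).
by apply: eq_bigl => x; rewrite inE.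
Qed.

Lemma tH_le (t delta : R) : 1 <= t -> 0 <= delta -> delta < 1 ->
  opnorm pi (deviation pi (geom_kernel P t)) <= delta ->
  (tH Prob X pi <= (t / (1 - Num.sqrt ((1 + delta ^+ 2) / 2)))%:E)%E.
Proof.
move=> t1 d0 d1 Kd; set c := 1 - _.
have c0 : 0 < c.
  rewrite subr_gt0 -[ltRHS]sqrtr1 ltr_sqrt//.
  have : delta ^+ 2 < 1 by rewrite expr_lt1.
  by lra.
apply: bigmax_le => [|A /andP[Aproper A_half]]; first exact: leNye.
have [_ [x _ xA]] := properP Aproper.
have D0 : 0 < mass pi (~: A) by apply: (@mass_gt0 _ _ _ _ x) => //; rewrite inE.
have D_half : mass pi (~: A) <= 2^-1 by have := massC A; rewrite massE in A_half *; lra.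
have dist := restrict_dist_distribution pi_ge0 D0.
apply: (expected_hitting_time_le sP dist (markovX dist)) => N.
rewrite mean_restrict_dist; last by move=> y; exact: trunc_hits_out.
rewrite ler_pdivrMr// mulrAC ler_pdivlMr// mulrC.
exact: mean_trunc_hits_le.
Qed.

Lemma expected_hitting_time_le_tH (D : {set V}) x : x \in D -> mass pi D <= 2^-1 ->
  (\int[Prob (restrict_dist pi D)]_w hitting_time X (~: D) w <= tH Prob X pi)%E.
Proof.
move=> xD D_half; rewrite -[D in restrict_dist _ D]finset.setCK.
apply: (le_bigmax_cond _ (fun A => \int[Prob (restrict_dist pi (~: A))]_w hitting_time X A w)%E).
rewrite -massE; apply/andP; split; last by have := massC D; lra.
by apply/properP; split; [exact: finset.subsetT|exists x; rewrite ?inE ?xD].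
Qed.

Lemma mean_trunc_hits_le_tH (D : {set V}) x N : x \in D -> mass pi D <= 2^-1 ->
  ((mean pi (trunc_hits P D N) / mass pi D)%:E <= tH Prob X pi)%E.
Proof.
move=> xD D_half; apply: le_trans (expected_hitting_time_le_tH xD D_half).
have dist := restrict_dist_distribution pi_ge0 (mass_gt0 pi_gt0 xD).
rewrite -mean_restrict_dist; last by move=> y; exact: trunc_hits_out.
have := expected_hitting_time_ge (~: D) N sP dist (markovX dist).
by rewrite finset.setCK.
Qed.

(** Of two distinct states one has mass at most 1/2, and leaving that singleton takes at least one
    step. *)
Lemma tH_ge1 : (1 < #|V|)%N -> (1 <= tH Prob X pi)%E.
Proof.
move=> /card_gt1P[x [y [_ _ xy]]].
wlog x_half : x y xy / pi x <= 2^-1.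
  move=> H; have [x_le|x_gt] := leP (pi x) 2^-1; first exact: H xy x_le.
  apply: (H y x); first by rewrite eq_sym.
  have [[_ pi1] _] := statP; move: pi1.
  rewrite (bigD1 x)//= (bigD1 y) /=; last by rewrite eq_sym.
  have : 0 <= \sum_(i | (i != x) && (i != y)) pi i by exact: sumr_ge0.
  by lra.
have xx : x \in [set x]%SET by rewrite inE.
have mx : mass pi [set x]%SET = pi x by rewrite massE big_set1.
have := @mean_trunc_hits_le_tH [set x]%SET x 1 xx; rewrite mx => /(_ x_half).
rewrite (_ : mean _ _ = pi x) ?divff ?gt_eqF//.
by rewrite -[RHS]mx; apply: eq_bigr => z _; rewrite /trunc_hits big_ord1.
Qed.

Lemma tH_quick_hits (T : R) : 0 <= T -> tH Prob X pi = T%:E -> quick_hits P pi T.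
Proof.
move=> T0 TE D D_half; apply: hits_of_bounded => // N.
(* The empty set is treated apart, since [pi] cannot be normalized on it. *)
have [D0|[x xD]] := set_0Vmem D.
  rewrite [leLHS]big1; last by move=> x _; rewrite trunc_hits_out ?mulr0// D0 inE.
  by rewrite mulr_ge0// sumr_ge0// => x _; rewrite mulr_ge0// ler0n.
have := mean_trunc_hits_le_tH N xD D_half.
by rewrite TE lee_fin ler_pdivrMr// (mass_gt0 pi_gt0 xD).
Qed.

End bounds.

Theorem theorem1p4 (R : realType) :
  exists c3 : R, 0 < c3 /\
  forall (V : finType) (P : V -> V -> R) (pi : V -> R)
    (d : measure_display) (Omega : measurableType d)
    (Prob : (V -> R) -> probability Omega R) (X : nat -> Omega -> V),
  (1 < #|V|)%N ->
  stochastic P -> irreducible P -> stationary P pi ->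
  markov_family P Prob X ->
  let trel := trel_geom P pi (expR 1)^-1 in
  let b : R := (1 + expR (- 2)) / 2 in
  (c3%:E * trel <= tH Prob X pi)%E /\
  (tH Prob X pi <= (1 / (1 - Num.sqrt b))%:E * trel)%E.
Proof.
(* When t_H = T is finite, 401 T is admissible in the infimum defining the relaxation time. *)
exists 401^-1; split; first by rewrite invr_gt0.
move=> V P pi d Omega Prob X V_gt1 sP irr statP markovX trel b.
have pi_gt0 := stationary_gt0 sP irr statP.
split.
  have T1 := tH_ge1 sP statP pi_gt0 markovX V_gt1.
  case TE : (tH Prob X pi) T1 => [T| |] // T1; last by rewrite leey.
  rewrite lee_fin in T1.
  have quickP : quick_hits P pi T.
    by apply: (tH_quick_hits sP statP pi_gt0 markovX _ TE); exact: le_trans T1.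
  rewrite [leRHS](_ : _ = 401^-1%:E * (401 * T)%:E)%E; last first.
    by rewrite -EFinM mulKf.
  apply: lee_wpmul2l; first by rewrite lee_fin invr_ge0.
  apply: ereal_inf_lbound; exists (401 * T) => //; split; first by lra.
  exact: opnorm_geom_kernel_le.
have -> : b = (1 + (expR 1)^-1 ^+ 2) / 2.
  by rewrite /b -expRN expr2 -expRD (_ : -1 + -1 = -2 :> R)//; ring.
have e_lt1 : (expR 1)^-1 < 1 :> R by rewrite invf_lt1 ?expR_gt0// expR_gt1.
have c0 : 0 < 1 - Num.sqrt ((1 + (expR 1)^-1 ^+ 2) / 2) :> R.
  rewrite subr_gt0 -[ltRHS]sqrtr1 ltr_sqrt//.
  have : (expR 1)^-1 ^+ 2 < 1 :> R by rewrite expr_lt1// invr_ge0 expR_ge0.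
  by lra.
(* Moving the positive factor inside the infimum leaves a bound to prove for each admissible t. *)
rewrite /trel /trel_geom -ereal_inf_pZl ?divr_gt0//.
apply: le_ereal_inf_tmp => _ [_ [t [t1 Kt] <-] <-].
rewrite -EFinM mul1r mulrC.
by apply: (tH_le sP statP pi_gt0 markovX t1) => //; rewrite invr_ge0 expR_ge0.
Qed.
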